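(* Let $q>0$ be a real number, let $\tau_q$ be the automorphism of $Q(\mathcal{C})$ given by $\tau_q(a/b)=\tau_q(a)/\tau_q(b)$ for $a,b\in\mathcal{C}$, $b\ne0$, where $\tau_q\{a(t)\}=\{q\,a(qt)\}$ on $\mathcal{C}$, and let $D=-s^2\frac{d}{ds}$. For every convergent power series $\sum_{n=0}^\infty\alpha_nX^n\in\mathbb{C}\{X\}$, $$\tau_q\left(\sum_{n=0}^\infty\alpha_nl^n\right)=\sum_{n=0}^\infty\alpha_nq^nl^n,\qquad D\left(\sum_{n=0}^\infty\alpha_nl^n\right)=\sum_{n=1}^\infty n\alpha_nl^{n-1}.$$ Hence $\mathbb{C}\{l\}$ is a DT subring of $(Q(\mathcal{C}),D,\tau_q)$, and its quotient field $Q(\mathbb{C}\{l\})$ is a DT subfield. Moreover, $Q(\mathbb{C}\{l\})$ may be regarded as a DT subfield of the field $\mathbb{C}((l))$ of formal Laurent series: the field embedding $Q(\mathbb{C}\{l\})\hookrightarrow\mathbb{C}((l))$ induced by sending $\sum_{n=0}^\infty\alpha_nl^n\in\mathbb{C}\{l\}$ to the formal power series with the same coefficients commutes with the derivations and the transforming operators, where $\mathbb{C}((l))$ carries the derivation $\sum_n\alpha_nl^n\mapsto\sum_n n\alpha_nl^{n-1}$ and the transforming operator $\sum_n\alpha_nl^n\mapsto\sum_n\alpha_nq^nl^n$.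
   Context: $\mathcal{C}$ is the set of complex-valued continuous functions on $[0,\infty)$; $f\in\mathcal{C}$ is written $\{f(t)\}$. It is a commutative ring without identity under pointwise addition and the convolution product $\{f(t)\}\{g(t)\}=\{\int_0^t f(t-u)g(u)\,du\}$. By Titchmarsh's theorem it has no zero divisors, and $Q(\mathcal{C})$ denotes its field of fractions; $a\in\mathcal{C}$ is identified with $ab/b$ for any nonzero $b\in\mathcal{C}$. A complex number $\alpha$ is identified with $\{\alpha\}/\{1\}\in Q(\mathcal{C})$, which makes $\mathbb{C}$ a subfield of $Q(\mathcal{C})$. Put $l=\{1\}\in\mathcal{C}$ (the constant function $1$) and $s=1/l\in Q(\mathcal{C})$. Convergence in $Q(\mathcal{C})$: a sequence $(a_n)$ in $Q(\mathcal{C})$ converges if there is $p\in Q(\mathcal{C})$, $p\ne0$, such that all $a_n/p$ lie in $\mathcal{C}$ and converge uniformly on every finite interval; the limit is $p\lim_n(a_n/p)$, and it is unique. Series are limits of partial sums. $\mathbb{C}\{X\}$ is the ring of convergent power series (positive radius of convergence). For $\sum\alpha_nX^n\in\mathbb{C}\{X\}$ the series $\sum_{n=0}^\infty\alpha_nl^n$ ($l^0=1$, powers by convolution) converges in $Q(\mathcal{C})$, and $\mathbb{C}\{l\}=\{\sum_{n=0}^\infty\alpha_nl^n : \sum_{n=0}^\infty\alpha_nX^n\in\mathbb{C}\{X\}\}\subset Q(\mathcal{C})$; it is a subring isomorphic to $\mathbb{C}\{X\}$ via $l\leftrightarrow X$ (the coefficients are uniquely determined). The derivation $\frac{d}{ds}$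 of $Q(\mathcal{C})$ is the unique extension, by the quotient rule, of the map $\{a(t)\}\mapsto\{-t\,a(t)\}$ on $\mathcal{C}$. A DT ring (field) is a ring (field) equipped with a derivation and a transforming operator (an injective endomorphism); a DT subring (subfield) is a subring (subfield) mapped into itself by both, with the restricted maps. *)

(* Defs.v *)
From HB Require Import structures.
From mathcomp Require Import all_boot all_order all_algebra.
From mathcomp Require Import all_classical all_reals all_analysis.
From mathcomp Require Import complex.
From mathcomp Require Import ring lra zify.
Set Implicit Arguments. Unset Strict Implicit. Unset Printing Implicit Defensive.
Import Order.TTheory GRing.Theory Num.Theory numFieldNormedType.Exports.
Local Open Scope classical_set_scope.
Local Open Scope ring_scope.
Local Open Scope complex_scope.

Section RealConv.
Variable R : realType.
Implicit Types (F G : R -> R) (x y t u : R).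
Local Notation mu := (@lebesgue_measure R).

Lemma halfline_ext F : {within `[0, +oo[, continuous F} ->
  continuous (fun x => F (Num.max x 0)).
Proof.
move=> /subspace_continuousP cF x.
have m0 : `[0, +oo[%classic (Num.max x 0).
  by rewrite /= in_itv/= andbT le_max lexx orbT.
apply: cvg_comp (cF _ m0) => A /= [e e0 eA].
have cm : {for x, continuous (fun y : R => Num.max y 0)}.
  apply: (@continuous_max R R (fun y => y) (fun=> 0)); first exact: cvg_id.
  exact: cvg_cst.
near=> y; apply: eA; last by rewrite /= in_itv/= andbT le_max lexx orbT.
by near: y; move/cvgrPdist_lt : cm; exact.
Unshelve. all: by end_near. Qed.

Lemma continuous_integrable F a b : continuous F ->
  mu.-integrable `[a, b] (EFin \o F).
Proof.
move=> cF; apply: continuous_compact_integrable; first exact: segment_compact.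
exact: continuous_subspaceT.
Qed.

Lemma continuous_bounded F a b : continuous F ->
  exists M, forall x, x \in `[a, b] -> `|F x| <= M.
Proof.
move=> cF; have [ab|ba] := leP a b; last first.
  by exists 0 => x; rewrite in_itv/= => /andP[ax xb]; move: (le_lt_trans (le_trans ax xb) ba); rewrite ltxx.
have [|c _ hc] := @EVT_max R (fun x => `|F x|) a b ab.
  by apply: continuous_subspaceT => x; apply: cvg_norm; exact: cF.
by exists `|F c|.
Qed.

Lemma within_halflineP F :
  (forall T, {within `[0, T], continuous F}) ->
  {within `[0, +oo[, continuous F}.
Proof.
move=> cF; apply/subspace_continuousP => x; rewrite /= in_itv/= andbT => x0.
have /subspace_continuousP/(_ x) := cF (x + 1).
rewrite /= in_itv/= x0 lerDl ler01 => /(_ isT) h A /h [e e0 eA].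
suff : \forall y \near x, `[0, +oo[%classic y -> A (F y) by [].
near=> y; rewrite /= in_itv/= andbT => y0; apply: eA => /=.
  by near: y; exact: nbhsx_ballx.
rewrite in_itv/= y0/=.
have : `|x - y| < 1 by near: y; apply: nbhsx_ballx; exact: ltr01.
by rewrite ltr_norml ltrBlDr addrC -ltrBlDr => /andP[/ltW + _]; lra.
Unshelve. all: by end_near. Qed.

Lemma within_rconv F G :
  {within `[0, +oo[, continuous F} -> {within `[0, +oo[, continuous G} ->
  {within `[0, +oo[, continuous
    (fun t => \int[mu]_(u in `[0, t]) (F (t - u) * G u))}.
Proof.
move=> /halfline_ext cF /halfline_ext cG.
set F1 := fun x => F (Num.max x 0) in cF; set G1 := fun x => G (Num.max x 0) in cG.
pose F0 x := F1 x - F1 0.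
have cF0 : continuous F0 by move=> x; apply: cvgB; [exact: cF|exact: cvg_cst].
have F0E x : x <= 0 -> F0 x = 0.
  by move=> x0; rewrite /F0 /F1 maxxx max_r// subrr.
apply: within_halflineP => T; apply/subspace_continuousP => t0 t0T.
have T0 : 0 <= T by move: t0T; rewrite /= in_itv/= => /andP[]; exact: le_trans.
have E t : t \in `[0, T]%classic -> \int[mu]_(u in `[0, T]) (F0 (t - u) * G1 u) +
     F1 0 * \int[mu]_(u in `[0, t]) G1 u
   = \int[mu]_(u in `[0, t]) (F (t - u) * G u).
  rewrite inE/= in_itv/= => /andP[t_ge0 tT].
  have cI : continuous (fun u => F0 (t - u) * G1 u).
    move=> u; apply: cvgM; last exact: cG.
    apply: (@continuous_comp _ _ _ (fun u : R => t - u) F0); last exact: cF0.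
    by apply: cvgB; [exact: cvg_cst|exact: cvg_id].
  have -> : \int[mu]_(u in `[0, T]) (F0 (t - u) * G1 u) =
            \int[mu]_(u in `[0, t]) (F0 (t - u) * G1 u).
    apply/eqP; rewrite -subr_eq0; apply/eqP.
    rewrite (@Rintegral_itvB R (fun u => F0 (t - u) * G1 u) (BLeft 0) (BRight T) t) ?bnd_simp//; last first.
      exact: continuous_integrable.
    transitivity (\int[mu]_(u in `]t, T]) (0 : R)); last by rewrite Rintegral_cst ?mul0r.
    apply: eq_Rintegral => u; rewrite inE/= in_itv/= => /andP[tu _].
    by rewrite F0E ?mul0r// subr_le0 ltW.
  rewrite -RintegralZl//; last exact: continuous_integrable.
  rewrite -RintegralD//; first last.
  - by apply: (@continuous_integrable (fun u => F1 0 * G1 u)) => u; apply: cvgM; [exact: cvg_cst|exact: cG].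
  - exact: continuous_integrable.
  apply: eq_Rintegral => u; rewrite inE/= in_itv/= => /andP[u0 ut].
  by rewrite /F0 -mulrDl subrK /F1 /G1 !max_l ?subr_ge0.
have := E t0; rewrite inE => /(_ t0T) Et0.

rewrite /from_subspace -Et0.
apply: cvg_trans.
  apply: (@fmap_within_eq _ `[0, T]%classic _ _ _
    (fun t => \int[mu]_(u in `[0, T]) (F0 (t - u) * G1 u) +
     F1 0 * \int[mu]_(u in `[0, t]) G1 u)).
  by move=> t tT /=; rewrite -E.
apply: cvgD; last first.
  apply: cvgMr; have := @parameterized_integral_continuous R 0 T G1 T0.
    by move=> /(_ (continuous_integrable 0 T cG))/subspace_continuousP; exact.
  apply: cvg_within_filter.
  have [A hA] := @continuous_bounded F0 (- (T + 1)) (T + 1) cF0.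
  have [B hB] := @continuous_bounded G1 0 T cG.
  have h := @continuity_under_integral R _ _ mu (fun x u => F0 (x - u) * G1 u)
    `[0, T]%classic _ (-1) (T + 1) _ _ (fun=> A * B) _ _ t0 _.
  apply: h => //.
  - move=> t _; apply: continuous_integrable => u; apply: cvgM; last exact: cG.
    apply: (@continuous_comp _ _ _ (fun u : R => t - u) F0); last exact: cF0.
    by apply: cvgB; [exact: cvg_cst|exact: cvg_id].
  - apply: aeW => /= u _ t _; apply: cvgM; last exact: cvg_cst.
    apply: (@continuous_comp _ _ _ (fun t : R => t - u) F0); last exact: cF0.
    by apply: cvgB; [exact: cvg_id|exact: cvg_cst].
  - by apply: continuous_integrable => u; exact: cvg_cst.
  - move=> t; rewrite /= in_itv/= => /andP[t1 t2]; apply: aeW => /= u.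
    rewrite in_itv/= => /andP[u0 uT]; rewrite normrM ler_pM// ?hA// ?hB//; rewrite in_itv/=; first by apply/andP; split; lra.
    by rewrite u0.
  - by move: t0T; rewrite inE/= !in_itv/= => /andP[? ?]; apply/andP; split; lra.
Unshelve. all: try by end_near. Qed.
End RealConv.

Section ComplexCts.
Variable R : realType.
Implicit Types (f g : R -> R[i]).

Lemma normc_real (a : R) : `|a%:C| = `|a|%:C.
Proof.
by rewrite normc_def/= -sqrtr_sqr; congr ((Num.sqrt _)%:C); ring.
Qed.

Lemma normc_i : `|'i%C : R[i]| = 1.
Proof.
by rewrite normc_def/= -[RHS]/(1%:C) -[in RHS]sqrtr1; congr ((Num.sqrt _)%:C); ring.
Qed.

Lemma within_complexP f (A : set R) :
  {within A, continuous (f : R -> R[i]^o)} <->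
  {within A, continuous (fun t => complex.Re (f t))} /\
  {within A, continuous (fun t => complex.Im (f t))}.
Proof.
have normcE (z : R[i]) : `|z| <= (`|complex.Re z| + `|complex.Im z|)%:C.
  rewrite {1}[z]complexE (le_trans (ler_normD _ _))// rmorphD/= lerD//.
    by rewrite normc_real.
  by rewrite normrM normc_i mul1r normc_real.
split=> [cf|[cr ci]].
  have h (p : R[i] -> R) : (forall z w, p (z - w) = p z - p w) ->
    (forall z, (`|p z|%:C <= `|z|)%R) -> {within A, continuous (fun t => p (f t))}.
    move=> pB pn x; apply/cvgrPdist_lt => e e0.
    have /cvgrPdist_lt/(_ e%:C) := cf x; rewrite ltcR => /(_ e0).
    apply: filterS => y; rewrite /from_subspace -pB => yf.
    by rewrite -ltcR (le_lt_trans _ yf)//; exact: pn.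
  split; apply: h.
  - by case=> a b [].
  - exact: normc_ge_Re.
  - by case=> a b [].
  - move=> z; rewrite (_ : complex.Im z = - complex.Re ('i%C * z)).
      by rewrite normrN (le_trans (normc_ge_Re _))// normrM normc_i mul1r.
    by case: z => a b /=; rewrite mul0r mul1r sub0r opprK.
move=> x; apply/cvgrPdist_lt => e.
case: e => e1 e2; rewrite ltcE/= => /andP[/eqP -> e0].
have e20 : 0 < e1 / 2 by rewrite divr_gt0.
have /cvgrPdist_lt/(_ _ e20) hr := cr x.
have /cvgrPdist_lt/(_ _ e20) hi := ci x.
near=> y.
have hry : `|complex.Re (f x) - complex.Re (f y)| < e1 / 2 by near: y; exact: hr.
have hiy : `|complex.Im (f x) - complex.Im (f y)| < e1 / 2 by near: y; exact: hi.
rewrite (le_lt_trans (normcE _))//.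
change ((`|complex.Re (f x - f y)| + `|complex.Im (f x - f y)|)%:C < e1%:C).
rewrite ltcR.
have -> : complex.Re (f x - f y) = complex.Re (f x) - complex.Re (f y).
  by case: (f x) => ? ?; case: (f y).
have -> : complex.Im (f x - f y) = complex.Im (f x) - complex.Im (f y).
  by case: (f x) => ? ?; case: (f y).
by lra.
Unshelve. all: by end_near. Qed.

End ComplexCts.

Section Cts.
Variable R : realType.
Implicit Types (a b : R -> R[i]).
Local Notation mu := (@lebesgue_measure R).

(* A continuous function on [0, +oo[ is encoded as a function on R that vanishes
   on the negative reals, so that Leibniz equality is equality on [0, +oo[. *)
Definition cts_halfline : {pred R -> R[i]} := fun a =>
  `[< {within `[0, +oo[, continuous (a : R -> R[i]^o)} /\
      forall t, t < 0 -> a t = 0 >].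

Record ctsfun := CtsFun { ctsfun_val :> R -> R[i]; _ : ctsfun_val \in cts_halfline }.

HB.instance Definition _ := [isSub for ctsfun_val].
HB.instance Definition _ := [Choice of ctsfun by <:].

Lemma cts_halflineP a : reflect
  ({within `[0, +oo[, continuous (a : R -> R[i]^o)} /\ forall t, t < 0 -> a t = 0)
  (a \in cts_halfline).
Proof. exact: asboolP. Qed.

Fact cts_halfline_zmod_closed : zmod_closed cts_halfline.
Proof.
split=> [|a b /cts_halflineP[ca a0] /cts_halflineP[cb b0]]; apply/cts_halflineP.
  by split=> // x; exact: cvg_cst.
split; first exact: (within_continuousB ca cb).
by move=> t t0; rewrite !fctE a0// b0// subrr.
Qed.
HB.instance Definition _ :=
  GRing.isZmodClosed.Build (R -> R[i]) cts_halfline cts_halfline_zmod_closed.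
HB.instance Definition _ := [SubChoice_isSubZmodule of ctsfun by <:].

Definition complex_integral (A : set R) (f : R -> R[i]) : R[i] :=
  (\int[mu]_(u in A) complex.Re (f u)) +i* (\int[mu]_(u in A) complex.Im (f u)).

Definition conv_fun a b t := complex_integral `[0, t] (fun u => a (t - u) * b u).

Fact conv_cts (f g : ctsfun) : conv_fun f g \in cts_halfline.
Proof.
case: f g => [f /= /cts_halflineP[cf f0]] [g /= /cts_halflineP[cg g0]].
apply/cts_halflineP; split; last first.
  move=> t t0; rewrite /conv_fun /complex_integral set_itv_ge ?bnd_simp -?ltNge//.
  by rewrite !Rintegral_set0.
have /within_complexP[cfr cfi] := cf; have /within_complexP[cgr cgi] := cg.
have int (F G : R -> R) : {within `[0, +oo[, continuous F} -> {within `[0, +oo[, continuous G} ->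
   forall t, mu.-integrable `[0, t] (EFin \o (fun u => F (t - u) * G u)).
  move=> /halfline_ext cF /halfline_ext cG t.
  apply: (@eq_integrable _ _ _ mu `[0, t]%classic _
    (EFin \o (fun u => F (Num.max (t - u) 0) * G (Num.max u 0)))) => //.
    move=> u; rewrite inE/= in_itv/= => /andP[u0 ut].
    by rewrite !max_l// subr_ge0.
  apply: continuous_integrable => u; apply: cvgM; last exact: cG.
  apply: (@continuous_comp _ _ _ (fun u : R => t - u) (fun x => F (Num.max x 0))); last exact: cF.
  by apply: cvgB; [exact: cvg_cst|exact: cvg_id].
have rr := int _ _ cfr cgr; have ii := int _ _ cfi cgi.
have ri := int _ _ cfr cgi; have ir := int _ _ cfi cgr.
apply/within_complexP; split.
- rewrite (_ : (fun t => _) = fun t =>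
    \int[mu]_(u in `[0, t]) (complex.Re (f (t - u)) * complex.Re (g u)) -
    \int[mu]_(u in `[0, t]) (complex.Im (f (t - u)) * complex.Im (g u))).
    exact: (within_continuousB (within_rconv cfr cgr) (within_rconv cfi cgi)).
  apply/funext => t /=; rewrite -RintegralB; [|by []|exact: rr|exact: ii].
  by apply: eq_Rintegral => u _; case: (f _) (g _) => ? ? [].
- rewrite (_ : (fun t => _) = fun t =>
    \int[mu]_(u in `[0, t]) (complex.Re (f (t - u)) * complex.Im (g u)) +
    \int[mu]_(u in `[0, t]) (complex.Im (f (t - u)) * complex.Re (g u))).
    exact: (within_continuousD (within_rconv cfr cgi) (within_rconv cfi cgr)).
  apply/funext => t /=; rewrite -RintegralD; [|by []|exact: ri|exact: ir].
  by apply: eq_Rintegral => u _; case: (f _) (g _) => ? ? [].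
Qed.
Definition conv f g := CtsFun (conv_cts f g).

Definition cst_fun (z : R[i]) (t : R) : R[i] := if t < 0 then 0 else z.

Fact cst_cts z : cst_fun z \in cts_halfline.
Proof.
apply/cts_halflineP; split; last by move=> t; rewrite /cst_fun => ->.
apply/subspace_continuousP => x; rewrite /= in_itv/= andbT => x0.
apply: cvg_trans.
  apply: (@fmap_within_eq R (`[0, +oo[%classic : set R) (R[i]^o) (nbhs x) (cst_fun z) (fun=> z)).
  by move=> t; rewrite inE/= in_itv/= andbT /cst_fun leNgt => /negbTE ->.
by rewrite /from_subspace /cst_fun ltNge x0/=; exact: cvg_cst.
Qed.
Definition cstC z := CtsFun (cst_cts z).

(* {a(t)} |-> {q a(q t)} *)
Definition dilate_fun (q : R) a t := q%:C * a (q * t).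

Fact dilate_cts (q : R) (q_gt0 : 0 < q) (f : ctsfun) : dilate_fun q f \in cts_halfline.
Proof.
case: f => [f /= /cts_halflineP[cf f0]]; apply/cts_halflineP; split; last first.
  by move=> t t0; rewrite /dilate_fun f0 ?mulr0// pmulr_rlt0.
apply/subspace_continuousP => x; rewrite /= in_itv/= andbT => x0.
move/subspace_continuousP : cf => cf.
apply: (@cvgMr R[i] _ _ _ (fun t => f (q * t) : R[i]^o) q%:C).
apply: (@cvg_comp _ _ _ (fun t => q * t) f _ (within `[0, +oo[%classic (nbhs (q * x)))); last first.
  by apply: cf; rewrite /= in_itv/= andbT mulr_ge0// ltW.
have : {for x, continuous (fun t : R => q * t)} by exact: mulrl_continuous.
move=> h A /h hA.
suff : \forall y \near x, `[0, +oo[%classic y -> A (q * y) by [].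
have hA' : nbhs (x : R) [set t : R | `[0, +oo[%classic (q * t) -> A (q * t)] := hA.
near=> y => y0.
have : [set t : R | `[0, +oo[%classic (q * t) -> A (q * t)] y by near: y; exact: hA'.
apply => /=.
by move: y0; rewrite /= !in_itv/= !andbT => y0; rewrite mulr_ge0// ltW.
Unshelve. all: by end_near. Qed.
Definition dilate q (q_gt0 : 0 < q) f := CtsFun (dilate_cts q_gt0 f).

(* {a(t)} |-> {- t a(t)} *)
Definition mulNt_fun a (t : R) : R[i] := (- t)%:C * a t.

Fact mulNt_cts (f : ctsfun) : mulNt_fun f \in cts_halfline.
Proof.
case: f => [f /= /cts_halflineP[cf f0]]; apply/cts_halflineP; split; last first.
  by move=> t t0; rewrite /mulNt_fun f0 ?mulr0.
move=> x; apply: (@cvgM R[i] _ _ _ (fun t : subspace `[0, +oo[ => (- (t : R))%:C : R[i]^o) (f : R -> R[i]^o)); last exact: cf.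
apply: (@continuous_subspaceT _ _ _ (fun t : R => (- t)%:C : R[i]^o)).
move=> y; apply/cvgrPdist_lt => e; case: e => e1 e2; rewrite ltcE/= => /andP[/eqP -> e0].
have h : \forall z \near (y : R), ball (y : R) e1 z by exact: nbhsx_ballx.
near=> z; rewrite -rmorphB normc_real opprK addrC ltcR.
have : ball (y : R) e1 z by near: z; exact: h.
by rewrite /ball/= distrC.
Unshelve. all: by end_near. Qed.
Definition mulNt f := CtsFun (mulNt_cts f).

End Cts.

Section Laurent.
Variable F : fieldType.
Implicit Types (c d e : int -> F) (M N : int).

Definition vanish_below c M := forall n, n < M -> c n = 0.

Definition laurent_pred : {pred int -> F} := fun c =>
  `[< exists M, vanish_below c M >].

(* Formal Laurent series: families of coefficients indexed by int with finite
   principal part. *)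
Record laurent := Laurent { lcoef :> int -> F; _ : lcoef \in laurent_pred }.

HB.instance Definition _ := [isSub for lcoef].
HB.instance Definition _ := [Choice of laurent by <:].

Lemma laurent_predP c : reflect (exists M, vanish_below c M) (c \in laurent_pred).
Proof. exact: asboolP. Qed.

Lemma vanish_belowW c M N : N <= M -> vanish_below c M -> vanish_below c N.
Proof. by move=> NM cM n nN; apply: cM; exact: lt_le_trans NM. Qed.

Fact laurent_zmod_closed : zmod_closed laurent_pred.
Proof.
split=> [|c d /laurent_predP[M cM] /laurent_predP[N dN]]; apply/laurent_predP.
  by exists 0.
exists (Num.min M N) => n; rewrite lt_min => /andP[nM nN].
by rewrite !fctE cM// dN// subrr.
Qed.
HB.instance Definition _ :=
  GRing.isZmodClosed.Build (int -> F) laurent_pred laurent_zmod_closed.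
HB.instance Definition _ := [SubChoice_isSubZmodule of laurent by <:].

(* Cauchy product: for every n the sum over i has finite support. *)
Definition lmul_fun c d (n : int) : F :=
  \sum_(i \in [set: int]) c i * d (n - i).

Lemma lmul_funE c d M N : vanish_below c M -> vanish_below d N ->
  forall k : nat, lmul_fun c d (M + N + k%:Z) =
    \sum_(j < k.+1) c (M + j%:Z) * d (N + (k - j)%N%:Z).
Proof.
move=> cM dN k; rewrite /lmul_fun.
rewrite -(fsbig_widen [set M + j%:Z | j in `I_k.+1] [set: int])//=; last first.
  move=> i [_ /= nI].
  have [iM|Mi] := ltP i M; first by rewrite cM ?mul0r.
  have [iN|Ni] := ltP (M + N + k%:Z - i) N; first by rewrite dN ?mulr0.
  exfalso; apply: nI; exists `|i - M|%N; last by lia.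
  by rewrite /=; lia.
rewrite (@reindex_fsbig _ _ _ nat int (fun j => M + j%:Z) `I_k.+1)//=; last first.
  split.
  - by move=> x xk; exists x.
  - by move=> x y _ _ /addrI [].
  - by move=> x.
rewrite -(fsbig_ord _ _ (fun j : nat => c (M + j%:Z) * d (M + N + k%:Z - (M + j%:Z)))).
by apply: eq_bigr => j _; congr (_ * d _); have := ltn_ord j; lia.
Qed.

Lemma lmul_fun0 c d M N : vanish_below c M -> vanish_below d N ->
  vanish_below (lmul_fun c d) (M + N).
Proof.
move=> cM dN n nMN; rewrite /lmul_fun fsbig1// => i _.
have [iM|Mi] := ltP i M; first by rewrite cM ?mul0r.
by rewrite dN ?mulr0//; lia.
Qed.

Fact lmul_subproof (c d : laurent) : lmul_fun c d \in laurent_pred.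
Proof.
case: c d => [c /= /laurent_predP[M cM]] [d /= /laurent_predP[N dN]].
by apply/laurent_predP; exists (M + N); exact: lmul_fun0.
Qed.
Definition lmul (c d : laurent) := Laurent (lmul_subproof c d).

Definition lone_fun (n : int) : F := (n == 0)%:R.
Fact lone_subproof : lone_fun \in laurent_pred.
Proof. by apply/laurent_predP; exists 0 => n n0; rewrite /lone_fun lt_eqF. Qed.
Definition lone := Laurent lone_subproof.

Lemma laurentP (c d : laurent) : (forall n, c n = d n) -> c = d.
Proof. by move=> h; apply/val_inj/funext. Qed.

Lemma laurent_bound (c : laurent) : exists M, vanish_below c M.
Proof. by case: c => c /= /laurent_predP. Qed.

Lemma vanish_ext c d M : vanish_below c M -> vanish_below d M ->
  (forall k : nat, c (M + k%:Z) = d (M + k%:Z)) -> forall n, c n = d n.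
Proof.
move=> cM dM h n; have [nM|Mn] := ltP n M; first by rewrite cM ?dM.
have -> : n = M + `|n - M|%N%:Z by lia.
exact: h.
Qed.

Let tr c M k := \poly_(j < k.+1) c (M + j%:Z).

Lemma lmul_tr c d M N : vanish_below c M -> vanish_below d N ->
  forall k m, (k <= m)%N -> lmul_fun c d (M + N + k%:Z) = (tr c M m * tr d N m)`_k.
Proof.
move=> cM dN k m km; rewrite (lmul_funE cM dN) coefM; apply: eq_bigr => j _.
rewrite !coef_poly !ifT//; first by rewrite ltnS (leq_trans (leq_subr _ _) km).
by rewrite ltnS (leq_trans _ km)// -ltnS.
Qed.

Lemma lmulC : commutative lmul.
Proof.
move=> c d; apply: laurentP => /=.
have [M cM] := laurent_bound c; have [N dN] := laurent_bound d.
apply: (vanish_ext (lmul_fun0 cM dN)); first by rewrite addrC; exact: lmul_fun0.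
by move=> k; rewrite (lmul_tr cM dN (leqnn k)) (addrC M) (lmul_tr dN cM (leqnn k)) mulrC.
Qed.

Lemma lmulA : associative lmul.
Proof.
move=> c d e; apply: laurentP => /=.
have [M cM] := laurent_bound c; have [N dN] := laurent_bound d.
have [K eK] := laurent_bound e.
have cdM := lmul_fun0 cM dN; have deM := lmul_fun0 dN eK.
apply: (vanish_ext (lmul_fun0 cM deM)); first by rewrite addrA; exact: lmul_fun0.
move=> k; rewrite (lmul_tr cM deM (leqnn k)) addrA (lmul_tr cdM eK (leqnn k)).
transitivity ((tr c M k * (tr d N k * tr e K k))`_k); last rewrite mulrA.
  rewrite [LHS]coefM [RHS]coefM; apply: eq_bigr => j _; congr (_ * _).
  rewrite [LHS]coef_poly ltnS leq_subr (lmul_tr dN eK (m := k))// ?leq_subr//.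
rewrite [RHS]coefM [LHS]coefM; apply: eq_bigr => j _; congr (_ * _).
by rewrite [RHS]coef_poly ltn_ord (lmul_tr cM dN (m := k))// -ltnS.
Qed.

Lemma lmul1 : left_id lone lmul.
Proof.
move=> c; apply: laurentP => /= n; rewrite /lmul_fun.
rewrite -(fsbig_widen [set 0 : int] [set: int])//=; last first.
  by move=> i [_ /= /eqP/negbTE i0]; rewrite /lone_fun i0 mul0r.
by rewrite fsbig_set1 /lone_fun eqxx mul1r subr0.
Qed.

Lemma lmulDl : left_distributive lmul +%R.
Proof.
move=> c d e; apply: laurentP => n /=.
have [M0 cM0] := laurent_bound c; have [N dN0] := laurent_bound d.
have [K eK] := laurent_bound e.
pose M := Num.min M0 N.
have cM : vanish_below c M by apply: vanish_belowW cM0; rewrite ge_min lexx.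
have dM : vanish_below d M by apply: vanish_belowW dN0; rewrite ge_min lexx orbT.
have cdM : vanish_below (c + d : laurent) M by move=> i iM; rewrite /= !fctE cM ?dM ?addr0.
have h : vanish_below (lmul c e + lmul d e : laurent) (M + K).
  by move=> i iM; rewrite /= !fctE !(@lmul_fun0 _ _ M K)// addr0.
move: n; apply: (vanish_ext (lmul_fun0 cdM eK) h) => k /=; rewrite !fctE.
rewrite (lmul_funE cdM eK) (lmul_funE cM eK) (lmul_funE dM eK) -big_split/=.
by apply: eq_bigr => j _; rewrite /= !fctE mulrDl.
Qed.

Lemma lone_neq0 : lone != 0.
Proof.
by apply/eqP => /(congr1 (fun c : laurent => c 0)) /= /eqP; rewrite /lone_fun eqxx oner_eq0.
Qed.

HB.instance Definition _ := GRing.Zmodule_isComNzRing.Build laurent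
  lmulA lmulC lmul1 lmulDl lone_neq0.

Lemma laurent_val (c : laurent) : c != 0 ->
  exists2 M, vanish_below c M & c M != 0.
Proof.
move=> c0; have [N cN] := laurent_bound c.
have ex : exists k : nat, c (N + k%:Z) != 0.
  apply/not_existsP => h; move/eqP: c0; apply.
  apply: laurentP; apply: (vanish_ext cN) => // k.
  by apply/eqP/negPn/negP; exact: h.
exists (N + (ex_minn ex)%:Z); last by case: ex_minnP.
case: ex_minnP => m _ hm n nNm; have [nN|Nn] := ltP n N; first exact: cN.
apply/eqP/negPn/negP => cn0; have := hm `|n - N|%N.
rewrite (_ : N + _ = n); last by lia.
by move=> /(_ cn0); lia.
Qed.

Fixpoint psinv (a : nat -> F) (n : nat) : seq F :=
  if n is m.+1 then
    rcons (psinv a m) (- (a 0)^-1 * \sum_(j < m) a (m - j)%N * (psinv a m)`_j + (m == 0)%:R * (a 0)^-1)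
  else [::].

Lemma size_psinv a n : size (psinv a n) = n.
Proof. by elim: n => //= n IH; rewrite size_rcons IH. Qed.

Lemma nth_psinv a n j : (j < n)%N -> (psinv a n)`_j = (psinv a j.+1)`_j.
Proof.
elim: n => // n IH; rewrite ltnS leq_eqVlt => /predU1P[->//|jn].
by rewrite [in LHS]/= nth_rcons size_psinv jn IH.
Qed.

Lemma psinvP a : a 0 != 0 -> forall k,
  \sum_(j < k.+1) a (k - j)%N * (psinv a j.+1)`_j = (k == 0)%:R.
Proof.
move=> a0 k; rewrite big_ord_recr/= subnn nth_rcons size_psinv ltnn eqxx.
rewrite mulrDr mulNr mulrN mulVKf// mulrCA mulfV// mulr1 addrA.
rewrite [X in X - _ + _](eq_bigr (fun j : 'I_k => a (k - j)%N * (psinv a k)`_j)); last first.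
  by move=> j _; rewrite [in RHS]nth_psinv.
by rewrite subrr add0r.
Qed.

Lemma laurent_inv (c : laurent) : c != 0 -> exists d : laurent, d * c = 1 :> laurent.
Proof.
move=> /laurent_val[M cM cM0]; pose a (k : nat) := c (M + k%:Z).
pose df (n : int) := if n < - M then 0 else (psinv a (absz (n + M)).+1)`_(absz (n + M)).
have dfM : vanish_below df (- M) by move=> n nM; rewrite /df nM.
have dP : df \in laurent_pred by apply/laurent_predP; exists (- M).
exists (Laurent dP); apply: laurentP.
have v0 : vanish_below (lmul (Laurent dP) c) 0.
  by rewrite -(addNr M); exact: lmul_fun0.
apply: (vanish_ext v0) => [n n0 /=|k]; first by rewrite /lone_fun lt_eqF.
rewrite -{1}(addNr M) /= (lmul_funE dfM cM) add0r /lone_fun.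
rewrite -[RHS](@psinvP a) /a ?addr0//; apply: eq_bigr => j _.
rewrite mulrC /df ltNge lerDl/= (_ : absz (- M + j%:Z + M) = j)//; lia.
Qed.

(* The inverse is unique; linv 0 = 0. *)
Definition linv (c : laurent) : laurent := xget 0 [set d : laurent | d * c = 1 :> laurent].

Fact lmulVf (c : laurent) : c != 0 -> linv c * c = 1 :> laurent.
Proof. by move=> /laurent_inv[d dc]; rewrite /linv; case: xgetP => [_ ->|/(_ d)]. Qed.

Fact linv0 : linv 0 = 0.
Proof.
rewrite /linv; case: xgetP => //= y -> /esym/eqP.
by rewrite mulr0 oner_eq0.
Qed.

HB.instance Definition _ := GRing.ComNzRing_isField.Build laurent lmulVf linv0.

(* sum_n c_n l^n |-> sum_n n c_n l^(n-1) *)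
Fact laurent_deriv_subproof (c : laurent) :
  (fun n : int => (n + 1)%:~R * c (n + 1)) \in laurent_pred.
Proof.
have [M cM] := laurent_bound c; apply/laurent_predP; exists (M - 1) => n nM.
by rewrite cM ?mulr0//; lia.
Qed.
Definition laurent_deriv (c : laurent) := Laurent (laurent_deriv_subproof c).

(* sum_n c_n l^n |-> sum_n c_n q^n l^n *)
Fact laurent_dilate_subproof (q : F) (c : laurent) :
  (fun n : int => c n * q ^ n) \in laurent_pred.
Proof.
have [M cM] := laurent_bound c; apply/laurent_predP; exists M => n nM.
by rewrite cM ?mul0r.
Qed.
Definition laurent_dilate (q : F) (c : laurent) := Laurent (laurent_dilate_subproof q c).

Fact laurent_of_pseries_subproof (a : nat -> F) :
  (fun n : int => if n is Posz m then a m else 0) \in laurent_pred.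
Proof. by apply/laurent_predP; exists 0; case. Qed.
Definition laurent_of_pseries a := Laurent (laurent_of_pseries_subproof a).

End Laurent.

Section DT.

Definition derivation (A : nzRingType) (D : A -> A) : Prop :=
  {morph D : x y / x + y} /\ forall x y, D (x * y) = D x * y + x * D y.

Definition transforming_operator (A : nzRingType) (tau : A -> A) : Prop :=
  [/\ injective tau, zmod_morphism tau & monoid_morphism tau].

Definition DT_ring (A : nzRingType) (D tau : A -> A) : Prop :=
  derivation D /\ transforming_operator tau.

Definition DT_subring (A : nzRingType) (D tau : A -> A) (B : set A) : Prop :=
  [/\ DT_ring D tau, GRing.subring_closed (fun x => x \in B),
      forall x, B x -> B (D x) & forall x, B x -> B (tau x)].

Definition DT_subfield (K : fieldType) (D tau : K -> K) (B : set K) : Prop :=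
  [/\ DT_ring D tau, GRing.divring_closed (fun x => x \in B),
      forall x, B x -> B (D x) & forall x, B x -> B (tau x)].

Definition field_embedding (K L : fieldType) (B : set K) (phi : K -> L) : Prop :=
  [/\ phi 1 = 1, {in B &, {morph phi : x y / x - y}},
      {in B &, {morph phi : x y / x * y}} & {in B &, injective phi}].

End DT.

(* The power series with coefficients alpha has a positive radius of
   convergence. *)
Definition convergent_pseries (R : realType) (alpha : nat -> R[i]) : Prop :=
  exists2 r : R, 0 < r & forall z : R[i], `|z| < r%:C ->
    cvgn (series (fun n => alpha n * z ^+ n : R[i]^o)).

(* Q is a field of fractions of the convolution ring ctsfun R, with canonical
   embedding iota. Such a Q exists because ctsfun R has no zero divisors
   (Titchmarsh), and (Q, iota) is unique up to a unique isomorphism. *)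
Record fraction_field (R : realType) (Q : fieldType) (iota : ctsfun R -> Q) :
    Prop := FractionField {
  frac_zmod : zmod_morphism iota;
  frac_conv : {morph iota : f g / conv f g >-> f * g};
  frac_inj : injective iota;
  frac_surj : forall x : Q, exists a b : ctsfun R, b != 0 /\ x = iota a / iota b
}.

Section Operators.
Variables (R : realType) (Q : fieldType) (iota : ctsfun R -> Q).

Definition op_l : Q := iota (cstC 1).
Definition op_s : Q := op_l^-1.
Definition op_scalar (z : R[i]) : Q := iota (cstC z) / iota (cstC 1).

(* The uniform limit g of the a_n / p on the intervals [0, T] is continuous,
   hence ranges over ctsfun R. *)
Definition op_cvg (a : nat -> Q) (x : Q) : Prop :=
  exists2 p : Q, p != 0 &
  exists (f : nat -> ctsfun R) (g : ctsfun R),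
  [/\ forall n, a n / p = iota (f n),
      forall T : R, {uniform `[0, T],
        (fun n => (f n : R -> R[i]^o)) @ \oo --> (g : R -> R[i]^o)} &
      x = p * iota g].

(* The sum over n >= m of u n converges to x. *)
Definition op_series (m : nat) (u : nat -> Q) (x : Q) : Prop :=
  op_cvg (fun N => \sum_(m <= n < N) u n) x.

Definition op_lseries (alpha : nat -> R[i]) (x : Q) : Prop :=
  op_series 0 (fun n => op_scalar (alpha n) * op_l ^+ n) x.

Definition op_Cl : set Q :=
  [set x | exists2 alpha, convergent_pseries alpha & op_lseries alpha x].

Definition op_QCl : set Q :=
  [set x | exists a b, [/\ op_Cl a, op_Cl b, b != 0 & x = a / b]].

(* In op_tau and op_ds the value y does not depend on the chosen fraction. *)
Definition op_tau (q : R) (q_gt0 : 0 < q) (x : Q) : Q :=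
  xget 0 [set y | exists a b : ctsfun R, [/\ b != 0, x = iota a / iota b &
    y = iota (dilate q_gt0 a) / iota (dilate q_gt0 b)]].

Definition op_ds (x : Q) : Q :=
  xget 0 [set y | exists a b : ctsfun R, [/\ b != 0, x = iota a / iota b &
    y = (iota (mulNt a) * iota b - iota a * iota (mulNt b)) / iota b ^+ 2]].

Definition op_D (x : Q) : Q := - op_s ^+ 2 * op_ds x.

(* phi restricts on Q(C{l}) to the field embedding induced by sending a
   convergent series in l to the formal series with the same coefficients. *)
Definition induced_embedding (phi : Q -> laurent R[i]) : Prop :=
  field_embedding op_QCl phi /\
  forall alpha x, convergent_pseries alpha -> op_lseries alpha x ->
    phi x = laurent_of_pseries alpha.

End Operators.

(* Main.v *)
From HB Require Import structures.
Require Import Defs.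
From mathcomp Require Import all_boot all_order all_algebra.
From mathcomp Require Import all_classical all_reals all_analysis.
From mathcomp Require Import complex.
From mathcomp Require Import ring lra zify.
Set Implicit Arguments. Unset Strict Implicit. Unset Printing Implicit Defensive.
Import Order.TTheory GRing.Theory Num.Theory numFieldNormedType.Exports.
Local Open Scope classical_set_scope.
Local Open Scope ring_scope.
Local Open Scope complex_scope.
Local Notation conv := Defs.conv.

(* If |alpha_n| <= M rho^n, then l * (sum of the alpha_n l^n) is the entire
   function sum of the alpha_n t^n / n!, because l^(n+1) = {t^n / n!}; the
   convergence is locally uniform by domination with exp(rho t).  The field
   operations, tau and D are continuous for the convergence of Q(C), so products,
   tau and D of a series in l can be computed on polynomials in l, where they
   follow from tau l = q l and D l = 1.  If the sum vanishes, then so do alpha_0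
   (evaluate the entire function at 0) and the derivative of the sum; hence all
   coefficients vanish by induction. *)

(** Partial sums are not stable under the operations: a product of two of them has extra
    coefficients beyond the truncation, and a derivative is one term short. The limit theorem is
    therefore proved for every sequence of polynomials whose coefficients share one exponential
    bound and agree with the given ones in a range growing with N. Convergence of a power series is
    used as an exponential bound on its coefficients, since such bounds pass easily to products and
    derivatives. The factor l in front of the sum is there because l^0 = 1 is not a function:
    multiplying by l moves every term into C. Elements of C{l} are given as limits, and an embedding
    phi is a function on all of Q(C) constrained on a subfield alone. So the coefficient map is
    handled as a relation, single-valued in both directions and closed under subtraction, product,
    the derivations and the transforming operators. Passing to fractions preserves this, and the
    closure properties, the embedding and the commutation are read off from the relation. *)

Section ComplexIntegral.
Variable R : realType.
Local Notation mu := (@lebesgue_measure R).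
Implicit Types (A : set R) (F G : R -> R[i]) (z : R[i]).

Lemma normc_le_ReIm z : `|z| <= (`|complex.Re z| + `|complex.Im z|)%:C.
Proof.
rewrite {1}[z]complexE (le_trans (ler_normD _ _))// rmorphD/= lerD//.
  by rewrite normc_real.
by rewrite normrM normc_i mul1r normc_real.
Qed.

Lemma normc_ge_Im z : `|complex.Im z|%:C <= `|z|.
Proof.
rewrite (_ : complex.Im z = - complex.Re ('i%C * z)).
  by rewrite normrN (le_trans (normc_ge_Re _))// normrM normc_i mul1r.
by case: z => a b /=; rewrite mul0r mul1r sub0r opprK.
Qed.

Lemma normc_leP z (e : R) : `|z| <= e%:C -> `|complex.Re z| <= e /\ `|complex.Im z| <= e.
Proof.
by move=> ze; split; rewrite -lecR (le_trans _ ze)// ?normc_ge_Re// normc_ge_Im.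
Qed.

Definition cintegrable A F :=
  mu.-integrable A (EFin \o (fun u => complex.Re (F u))) /\
  mu.-integrable A (EFin \o (fun u => complex.Im (F u))).

Lemma eq_complex_integral A F G : (forall u, A u -> F u = G u) ->
  complex_integral A F = complex_integral A G.
Proof.
move=> FG; rewrite /complex_integral; congr (_ +i* _);
  by apply: eq_Rintegral => u; rewrite inE => /FG ->.
Qed.

Lemma complex_integralD A F G : measurable A -> cintegrable A F -> cintegrable A G ->
  complex_integral A (fun u => F u + G u) = complex_integral A F + complex_integral A G.
Proof.
move=> mA [F1 F2] [G1 G2]; rewrite /complex_integral.
transitivity ((\int[mu]_(u in A) (complex.Re (F u) + complex.Re (G u))) +i*
  (\int[mu]_(u in A) (complex.Im (F u) + complex.Im (G u)))).
  by congr (_ +i* _); apply: eq_Rintegral => u _; case: (F u) (G u) => ? ? [].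
by rewrite !RintegralD.
Qed.

Lemma complex_integralZ A F (r : R) : measurable A -> cintegrable A F ->
  complex_integral A (fun u => r%:C * F u) = r%:C * complex_integral A F.
Proof.
move=> mA [F1 F2]; rewrite /complex_integral.
transitivity ((\int[mu]_(u in A) (r * complex.Re (F u))) +i*
  (\int[mu]_(u in A) (r * complex.Im (F u)))).
  congr (_ +i* _); apply: eq_Rintegral => u _; case: (F u) => ? ? /=.
    by rewrite mul0r subr0.
  by rewrite mul0r addr0.
rewrite !RintegralZl//; apply/eqP; rewrite eq_complex/= !mul0r subr0 addr0.
by rewrite !eqxx.
Qed.

(** The factor 2 comes from bounding the real and the imaginary integral separately by [M * t]; this
    crude form is enough for continuity of the convolution. *)
Lemma le_norm_complex_integral F (t M : R) : 0 <= t -> cintegrable `[0, t] F ->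
  (forall u, u \in `[0, t] -> `|F u| <= M%:C) ->
  `|complex_integral `[0, t] F| <= (2 * (M * t))%:C.
Proof.
move=> t0 [F1 F2] FM; apply: (le_trans (normc_le_ReIm _)); rewrite lecR/=.
have bnd (h : R -> R) : mu.-integrable `[0, t] (EFin \o h) ->
    (forall u, u \in `[0, t] -> `|h u| <= M) ->
    `|\int[mu]_(u in `[0, t]) h u| <= M * t.
  move=> ih hM; apply: (le_trans (le_normr_Rintegral _ ih)) => //.
  have <- : \int[mu]_(u in `[0, t]) (fun=> M) u = M * t.
    rewrite Rintegral_cst//= lebesgue_measure_itv/= lte_fin.
    by case: ltP => h0 /=; rewrite ?subr0//; congr (_ * _); apply/le_anti; rewrite t0 h0.
  apply: le_Rintegral => //.
  - exact: (integrable_norm ih).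
  - by apply: continuous_integrable => u; exact: cvg_cst.
have := bnd _ F1 (fun u ut => (normc_leP (FM u ut)).1).
have := bnd _ F2 (fun u ut => (normc_leP (FM u ut)).2).
by clear; rewrite mulr2n; lra.
Qed.
End ComplexIntegral.

(** * Convolution, and how multiplication by -t and dilation act on it *)

Section Convolution.
Variable R : realType.
Local Notation mu := (@lebesgue_measure R).
Implicit Types (f g h : ctsfun R) (t u : R) (z : R[i]).

Lemma ctsfun_lt0 f t : t < 0 -> f t = 0.
Proof. by case: f => f /= /cts_halflineP[_]; exact. Qed.

Lemma ctsfunP f g : (forall t, 0 <= t -> f t = g t) -> f = g.
Proof.
move=> fg; apply/val_inj/funext => t /=.
by have [/fg//|t0] := leP 0 t; rewrite !ctsfun_lt0.
Qed.

(** Extended by 0 to the negative reals, [f] may jump at 0. Freezing it at its value in 0 instead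
    gives functions continuous on the whole line, to which integrability and substitution results
    apply. *)
Lemma ctsfun_ext f : exists F G : R -> R, [/\ continuous F, continuous G &
  forall t, 0 <= t -> f t = F t +i* G t].
Proof.
case: f => f /= /cts_halflineP[/within_complexP[cr ci] _].
exists (fun x => complex.Re (f (Num.max x 0))), (fun x => complex.Im (f (Num.max x 0))).
split; first exact: (halfline_ext cr).
- exact: (halfline_ext ci).
- by move=> t t0; rewrite max_l//; case: (f t).
Qed.

Lemma ctsfun_bounded f (T : R) : exists2 M : R, 0 <= M &
  forall t, t \in `[0, T] -> `|f t| <= M%:C.
Proof.
have [F [G [cF cG fE]]] := ctsfun_ext f.
have [A hA] := @continuous_bounded R F 0 T cF.
have [B hB] := @continuous_bounded R G 0 T cG.
exists (`|A| + `|B|) => // t tT; have := tT; rewrite in_itv/= => /andP[t0 _].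
rewrite fE// (le_trans (normc_le_ReIm _))// lecR/= lerD//.
  exact: le_trans (hA _ tT) (ler_norm _).
exact: le_trans (hB _ tT) (ler_norm _).
Qed.

Lemma conv_cintegrable f g t : cintegrable `[0, t] (fun u => f (t - u) * g u).
Proof.
have [F1 [F2 [cF1 cF2 fE]]] := ctsfun_ext f.
have [G1 [G2 [cG1 cG2 gE]]] := ctsfun_ext g.
have cB (F : R -> R) : continuous F -> continuous (fun u => F (t - u)).
  move=> cF u; apply: (@continuous_comp _ _ _ (fun u : R => t - u) F); last exact: cF.
  by apply: cvgB; [exact: cvg_cst|exact: cvg_id].
have E u : u \in `[0, t] -> f (t - u) * g u =
    (F1 (t - u) +i* F2 (t - u)) * (G1 u +i* G2 u).
  by rewrite in_itv/= => /andP[u0 ut]; rewrite fE ?gE// subr_ge0.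
split.
- apply: (@eq_integrable _ _ _ mu `[0, t]%classic _
    (EFin \o (fun u => F1 (t - u) * G1 u - F2 (t - u) * G2 u))) => //.
    by move=> u; rewrite inE /= => /E ->.
  apply: continuous_integrable => u.
  apply: cvgB; apply: cvgM;
    by first [exact: cG1|exact: cG2|exact: (cB _ cF1)|exact: (cB _ cF2)].
- apply: (@eq_integrable _ _ _ mu `[0, t]%classic _
    (EFin \o (fun u => F1 (t - u) * G2 u + F2 (t - u) * G1 u))) => //.
    by move=> u; rewrite inE /= => /E ->.
  apply: continuous_integrable => u.
  apply: cvgD; apply: cvgM;
    by first [exact: cG1|exact: cG2|exact: (cB _ cF1)|exact: (cB _ cF2)].
Qed.

Lemma le_norm_conv f g (T t A B : R) : 0 <= A -> 0 <= B -> t \in `[0, T] ->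
  (forall u, u \in `[0, T] -> `|f u| <= A%:C) ->
  (forall u, u \in `[0, T] -> `|g u| <= B%:C) ->
  `|conv f g t| <= (2 * T * A * B)%:C.
Proof.
move=> A0 B0; rewrite in_itv/= => /andP[t0 tT] fA gB.
apply: (@le_trans _ _ (2 * (A * B * t))%:C).
  apply: le_norm_complex_integral => //; first exact: conv_cintegrable.
  move=> u; rewrite in_itv/= => /andP[u0 ut].
  rewrite normrM rmorphM/= ler_pM//; [apply: fA|apply: gB]; rewrite in_itv/=.
    by apply/andP; split; lra.
  by rewrite u0 (le_trans ut tT).
rewrite lecR (_ : 2 * T * A * B = 2 * (A * B * T)); last by ring.
by rewrite ler_pM2l// ler_wpM2l// mulr_ge0.
Qed.

Lemma mulNtD f g : mulNt (f + g) = mulNt f + mulNt g.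
Proof. by apply/ctsfunP => t _ /=; rewrite /mulNt_fun !fctE mulrDr. Qed.

(** Under the integral, - t = - (t - u) + - u gives one term for each factor. This Leibniz rule is
    what makes d/ds a derivation. *)
Lemma mulNt_conv f g : mulNt (conv f g) = conv (mulNt f) g + conv f (mulNt g).
Proof.
apply/ctsfunP => t t0 /=; rewrite !fctE /mulNt_fun /conv_fun.
rewrite -complex_integralZ//; last exact: (conv_cintegrable f g t).
rewrite -complex_integralD//;
  [|exact: (conv_cintegrable (mulNt f) g t)|exact: (conv_cintegrable f (mulNt g) t)].
apply: eq_complex_integral => u _; rewrite /mulNt_fun.
rewrite (_ : - t = - (t - u) + - u) ?rmorphD/=; first by ring.
by rewrite opprB addrAC subrr add0r.
Qed.

Variables (q : R) (q_gt0 : 0 < q).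

Lemma dilate_zmod : zmod_morphism (dilate q_gt0).
Proof. by move=> f g; apply/ctsfunP => t _ /=; rewrite /dilate_fun !fctE mulrBr. Qed.

Lemma dilate_inj : injective (dilate q_gt0).
Proof.
move=> f g /(congr1 (fun h : ctsfun R => (h : R -> R[i]))) /= fg.
apply/ctsfunP => t _; have := congr1 (fun h : R -> R[i] => h (q^-1 * t)) fg.
rewrite /dilate_fun mulrA divff ?gt_eqF// mul1r => /mulfI; apply.
by rewrite (fmorph_eq0 (real_complex R)) gt_eqF.
Qed.

Lemma Rintegral_dilate (F : R -> R) t : 0 <= t -> continuous F ->
  \int[mu]_(u in `[0, q * t]) F u = \int[mu]_(u in `[0, t]) (q * F (q * u)).
Proof.
move=> t0 cF; rewrite /Rintegral; congr fine.
have D x : is_derive (x : R) (1 : R) (fun u : R => q * u) q.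
  rewrite (_ : (fun u : R => q * u) = q \*: (@id R))//.
  by apply: is_derive_eq; rewrite /GRing.scale/= mulr1.
have dE : ((fun u : R => q * u)^`())%classic = cst q.
  by apply/funext => x; rewrite derive1E; have := D x => ?; exact: derive_val.
have := @integration_by_substitution_increasing R (fun u => q * u) F 0 t t0.
rewrite mulr0 => ->.
- by apply: eq_integral => u _; rewrite /= dE mulrC.
- by move=> x y _ _ xy; rewrite ltr_pM2l.
- by rewrite dE => x _; exact: cvg_cst.
- by rewrite dE; exact: is_cvg_cst.
- by rewrite dE; exact: is_cvg_cst.
- have cq : continuous (fun u : R => q * u) by exact: mulrl_continuous.
  split.
  + by move=> x _; have := D x => ?; exact: ex_derive.
  + by apply: cvg_at_right_filter; exact: cq.
  + by apply: cvg_at_left_filter; exact: cq.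
- exact: continuous_subspaceT.
Qed.

(** The substitution u -> q u yields one factor q, the dilation of the left side another; these are
    the two factors carried by the dilates on the right. *)
Lemma dilate_conv f g : dilate q_gt0 (conv f g) = conv (dilate q_gt0 f) (dilate q_gt0 g).
Proof.
apply/ctsfunP => t t0 /=; rewrite /dilate_fun /conv_fun.
have [F1 [F2 [cF1 cF2 fE]]] := ctsfun_ext f.
have [G1 [G2 [cG1 cG2 gE]]] := ctsfun_ext g.
have qt0 : 0 <= q * t by rewrite mulr_ge0// ltW.
have cB s (F : R -> R) : continuous F -> continuous (fun u => F (s - u)).
  move=> cF u; apply: (@continuous_comp _ _ _ (fun u : R => s - u) F); last exact: cF.
  by apply: cvgB; [exact: cvg_cst|exact: cvg_id].
(* [H] is the integrand with both factors replaced by their continuous extensions, as the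
   substitution requires. *)
pose H s u := (F1 (s - u) +i* F2 (s - u)) * (G1 u +i* G2 u).
have E s u : u \in `[0, s] -> f (s - u) * g u = H s u.
  by rewrite in_itv/= => /andP[u0 us]; rewrite /H fE ?gE// subr_ge0.
rewrite (@eq_complex_integral _ _ _ (H (q * t))) => [|u /= /E//].
have -> : complex_integral `[0, q * t] (H (q * t)) =
    complex_integral `[0, t] (fun u => q%:C * H (q * t) (q * u)).
  rewrite /complex_integral; congr (_ +i* _); rewrite Rintegral_dilate//.
  - apply: eq_Rintegral => u _ /=; rewrite mul0r subr0//.
  - move=> u; apply: cvgB; apply: cvgM;
      first [exact: cG1|exact: cG2|exact: (cB _ _ cF1)|exact: (cB _ _ cF2)].
  - apply: eq_Rintegral => u _ /=; rewrite mul0r addr0//.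
  - move=> u; apply: cvgD; apply: cvgM;
      first [exact: cG1|exact: cG2|exact: (cB _ _ cF1)|exact: (cB _ _ cF2)].
have qq : q%:C != 0 :> R[i] by rewrite (fmorph_eq0 (real_complex R)) gt_eqF.
(* The product of the dilates contains q twice, the substituted integrand once; [q^-1] balances this
   and cancels the outer [q] at the end. *)
transitivity (q%:C * complex_integral `[0, t]
    (fun u => (q^-1)%:C * (dilate q_gt0 f (t - u) * dilate q_gt0 g u))).
  congr (_ * _); apply: eq_complex_integral => u /= ut; rewrite /dilate_fun mulrBr -E.
    by rewrite mulrACA !mulrA -rmorphM/= mulVf ?gt_eqF// mul1r.
  move: ut; rewrite !in_itv/= => /andP[u0 ut].
  by apply/andP; split; [rewrite mulr_ge0// ltW|rewrite ler_pM2l].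
rewrite complex_integralZ//; last exact: (conv_cintegrable (dilate q_gt0 f) (dilate q_gt0 g) t).
by rewrite mulrA -rmorphM/= mulfV ?gt_eqF// mul1r.
Qed.
End Convolution.

(** * Locally uniform convergence in C, and the powers of l as functions *)

Section UniformConvergence.
Variable R : realType.
Implicit Types (f g : nat -> ctsfun R) (a b : ctsfun R) (T t e : R).

Definition ucvg f a := forall T, {uniform `[0, T],
  (fun n => (f n : R -> R[i]^o)) @ \oo --> (a : R -> R[i]^o)}.

Lemma ucvgP f a : ucvg f a <-> forall T e, 0 < e ->
  \forall n \near \oo, forall t, t \in `[0, T] -> `|f n t - a t| <= e%:C.
Proof.
split=> [fa T e e0|fa T].
  have e0' : 0 < e%:C by rewrite ltcR.
  have := fa T [set h : R -> R[i]^o | forall t, t \in `[0, T] -> `|h t - a t| <= e%:C].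
  apply; apply/uniform_nbhs.
  exists [set xy | ball xy.1 e%:C xy.2]; split.
    by rewrite -entourage_ballE; exists e%:C.
  move=> h /= hE t tT; have := hE t tT.
  by rewrite /ball/= /ball_/= distrC => /ltW.
move=> P /uniform_nbhs[E [/= entE EP]].
move: entE; rewrite -entourage_ballE => -[[e e'] /= ].
(* A positive complex radius has imaginary part 0, so real radii suffice. *)
rewrite ltcE/= => /andP[/eqP -> e0] eE.
have e20 : 0 < e / 2 by rewrite divr_gt0.
have [N _ hN] := fa T _ e20; exists N => // n /= Nn; apply: EP => t tT.
apply: eE; rewrite /ball/= /ball_/= distrC (le_lt_trans (hN n Nn t tT))//.
by rewrite ltcR; move: e0; clear; lra.
Qed.

Lemma ucvg_pointwise f a t : 0 <= t -> ucvg f a ->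
  (fun n => f n t : R[i]^o) @ \oo --> (a t : R[i]^o).
Proof.
move=> t0 /ucvgP fa; apply/cvgrPdist_lt => -[e e']; rewrite ltcE/= => /andP[/eqP -> e0].
have e20 : 0 < e / 2 by rewrite divr_gt0.
apply: filterS (fa t _ e20) => n /(_ t); rewrite in_itv/= t0 lexx => /(_ isT) h.
by rewrite distrC (le_lt_trans h)// ltcR; move: e0; clear; lra.
Qed.

Lemma ucvg_unique f a b : ucvg f a -> ucvg f b -> a = b.
Proof.
move=> fa fb; apply/ctsfunP => t t0.
exact: (norm_cvg_unique (ucvg_pointwise t0 fa) (ucvg_pointwise t0 fb)).
Qed.

Lemma ctsfunDE a b t : (a + b) t = a t + b t.
Proof. by []. Qed.

Lemma ucvg_cst a : ucvg (fun=> a) a.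
Proof.
apply/ucvgP => T e e0; near=> n => t _.
by rewrite subrr normr0 lecR ltW.
Unshelve. all: by end_near. Qed.

Lemma ucvgD f g a b : ucvg f a -> ucvg g b -> ucvg (fun n => f n + g n) (a + b).
Proof.
move=> /ucvgP fa /ucvgP gb; apply/ucvgP => T e e0.
have e20 : 0 < e / 2 by rewrite divr_gt0.
near=> n => t tT.
have h1 : `|f n t - a t| <= (e / 2)%:C.
  by move: t tT; near: n; exact: fa.
have h2 : `|g n t - b t| <= (e / 2)%:C.
  by move: t tT {h1}; near: n; exact: gb.
rewrite ctsfunDE opprD addrACA (le_trans (ler_normD _ _))//.
by rewrite [in leRHS](splitr e) rmorphD/= lerD.
Unshelve. all: by end_near. Qed.

Lemma convDl a b (c : ctsfun R) : conv (a + b) c = conv a c + conv b c.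
Proof.
apply/ctsfunP => t t0; rewrite ctsfunDE /= /conv_fun.
rewrite -complex_integralD//;
  [|exact: (conv_cintegrable a c t)|exact: (conv_cintegrable b c t)].
by apply: eq_complex_integral => u _; rewrite -mulrDl.
Qed.

Lemma convDr a b (c : ctsfun R) : conv c (a + b) = conv c a + conv c b.
Proof.
apply/ctsfunP => t t0; rewrite ctsfunDE /= /conv_fun.
rewrite -complex_integralD//;
  [|exact: (conv_cintegrable c a t)|exact: (conv_cintegrable c b t)].
by apply: eq_complex_integral => u _; rewrite -mulrDr.
Qed.

Lemma ucvg_conv f g a b : ucvg f a -> ucvg g b -> ucvg (fun n => conv (f n) (g n)) (conv a b).
Proof.
move=> /ucvgP fa /ucvgP gb; apply/ucvgP => T e e0.
have [T0|T0] := ltP T 0.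
  near=> n => t; rewrite in_itv/= => /andP[t0 tT].
  by move: (le_lt_trans (le_trans t0 tT) T0); rewrite ltxx.
have [A A0 aA] := ctsfun_bounded a T; have [B B0 bB] := ctsfun_bounded b T.
(* The three terms of the bilinear expansion are at most 2 T d d, 2 T d B and 2 T A d; with d <= 1
   their sum is at most d C. The final 1 keeps [C] positive when T = 0. *)
pose C := 2 * T * (1 + A + B) + 1.
have C0 : 0 < C by rewrite /C; nra.
pose d := Num.min 1 (e / C).
have d0 : 0 < d by rewrite lt_min ltr01 divr_gt0.
have d1 : d <= 1 by rewrite ge_min lexx.
have dC : d * C <= e by rewrite -ler_pdivlMr// ge_min lexx orbT.
near=> n => t tT.
have h1 : forall t, t \in `[0, T] -> `|(f n - a) t| <= d%:C.
  by near: n; exact: fa.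
have h2 : forall t, t \in `[0, T] -> `|(g n - b) t| <= d%:C.
  by near: n; exact: gb.
have -> : conv (f n) (g n) t - conv a b t =
    conv (f n - a) (g n - b) t + conv (f n - a) b t + conv a (g n - b) t.
  have -> : conv (f n) (g n) = conv ((f n - a) + a) ((g n - b) + b) by rewrite !subrK.
  by rewrite convDl !convDr !ctsfunDE addrA addrK.
have ltd := ltW d0.
rewrite (le_trans (ler_normD _ _))//.
apply: (@le_trans _ _ ((2 * T * d * d)%:C + (2 * T * d * B)%:C + (2 * T * A * d)%:C)).
  rewrite lerD//; last exact: le_norm_conv.
  by rewrite (le_trans (ler_normD _ _))// lerD//; exact: le_norm_conv.
rewrite -!rmorphD/= lecR (le_trans _ dC)//.
have h3 : 2 * T * (d * d) <= 2 * T * d by rewrite ler_wpM2l ?mulr_ge0// ler_piMl.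
by move: h3 ltd; rewrite /C; clear; lra.
Unshelve. all: by end_near. Qed.

Lemma ucvg_mulNt f a : ucvg f a -> ucvg (fun n => mulNt (f n)) (mulNt a).
Proof.
move=> /ucvgP fa; apply/ucvgP => T e e0.
have C0 : 0 < `|T| + 1 by rewrite ltr_wpDl.
have d0 : 0 < e / (`|T| + 1) by rewrite divr_gt0.
apply: filterS (fa T _ d0) => n h t tT; have := h t tT => {}h.
rewrite /= /mulNt_fun -mulrBr normrM normc_real.
rewrite (_ : e = (`|T| + 1) * (e / (`|T| + 1))); last first.
  by rewrite mulrC divfK// gt_eqF.
rewrite rmorphM/= ler_pM//; first by rewrite lecR.
rewrite lecR normrN; move: tT; rewrite in_itv/= => /andP[t0 tT].
by rewrite ger0_norm// (le_trans tT)// (le_trans (ler_norm _))// lerDl.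
Qed.

Lemma ucvg_dilate q (q_gt0 : 0 < q) f a :
  ucvg f a -> ucvg (fun n => dilate q_gt0 (f n)) (dilate q_gt0 a).
Proof.
move=> /ucvgP fa; apply/ucvgP => T e e0.
have d0 : 0 < e / q by rewrite divr_gt0.
apply: filterS (fa (q * T) _ d0) => n h t; rewrite in_itv/= => /andP[t0 tT].
rewrite /= /dilate_fun -mulrBr normrM normc_real (gtr0_norm q_gt0).
rewrite (_ : e = q * (e / q)); last by rewrite mulrC divfK// gt_eqF.
rewrite rmorphM/= ler_pM2l ?ltcR//; apply: h.
by rewrite in_itv/= ler_pM2l// tT andbT mulr_ge0// ltW.
Qed.

Fact scale_cts (z : R[i]) a : (fun t => z * a t) \in @cts_halfline R.
Proof.
case: a => a /= /cts_halflineP[ca a0]; apply/cts_halflineP; split.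
  move=> x; apply: (@cvgM R[i] _ _ _ (fun t : subspace `[0, +oo[ => z : R[i]^o)
    (a : R -> R[i]^o)); last exact: ca.
  exact: cvg_cst.
by move=> t /a0 ->; rewrite mulr0.
Qed.
Definition cscale z a := CtsFun (scale_cts z a).

(** For 0 <= u <= t the kernel is the constant z and can be moved to the other factor. Divided by l,
    this says that the scalar z acts on functions by pointwise multiplication. *)
Lemma conv_cst z a : conv (cstC z) a = conv (cstC 1) (cscale z a).
Proof.
apply/ctsfunP => t t0; apply: eq_complex_integral => u /=.
rewrite in_itv/= => /andP[u0 ut].
by rewrite /cst_fun ltNge subr_ge0 ut/= mul1r.
Qed.

Fixpoint mono k : ctsfun R :=
  if k is k'.+1 then conv (cstC 1) (mono k') else cstC 1.

Lemma monoE k t : 0 <= t -> mono k t = (t ^+ k / k`!%:R)%:C.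
Proof.
elim: k t => [|k IH] t t0; first by rewrite /= /cst_fun ltNge t0/= fact0 divr1.
(* The fundamental theorem of calculus is applied on a nondegenerate interval, so t = 0 is treated
   apart. *)
have [t_gt0|tle0] := ltP 0 t; last first.
  have -> : t = 0 by apply/le_anti; rewrite t0 tle0.
  rewrite /= /conv_fun /complex_integral set_itv1 !Rintegral_set1.
  by rewrite expr0n mul0r.
rewrite /= /conv_fun.
rewrite (@eq_complex_integral _ _ _ (fun u => (u ^+ k / k`!%:R)%:C)); last first.
  move=> u /=; rewrite in_itv/= => /andP[u0 ut].
  by rewrite /cst_fun ltNge subr_ge0 ut/= mul1r IH.
rewrite /complex_integral/= Rintegral_cst//= mul0r; congr (_ +i* _).
have D x : is_derive (x : R) (1 : R) (fun u : R => u ^+ k.+1 / (k.+1)`!%:R) (x ^+ k / k`!%:R).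
  rewrite (_ : (fun u : R => _) = (k.+1)`!%:R^-1 \*: ((@id R) ^+ k.+1)); last first.
    by apply/funext => u; rewrite /= exprfctE /GRing.scale/= mulrC.
  apply: is_derive_eq.
  rewrite /GRing.scale/= mulr1 factS natrM invfM.
  by rewrite mulrACA mulVf ?mul1r ?pnatr_eq0// mulrC.
rewrite /Rintegral (@continuous_FTC2 R _ (fun u => u ^+ k.+1 / (k.+1)`!%:R))//=.
- by rewrite expr0n/= mul0r subr0.
- apply: continuous_subspaceT => x.
  by apply: cvgM; [exact: exprn_continuous|exact: cvg_cst].
- have cF : continuous (fun u : R => u ^+ k.+1 / (k.+1)`!%:R).
    by move=> x; apply: cvgM; [exact: exprn_continuous|exact: cvg_cst].
  split.
  + by move=> x _; have := D x => ?; exact: ex_derive.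
  + by apply: cvg_at_right_filter; exact: cF.
  + by apply: cvg_at_left_filter; exact: cF.
- by move=> x _; rewrite derive1E; have := D x => ?; exact: derive_val.
Qed.

End UniformConvergence.

(** * Exponential bounds on coefficients, and limits of Borel transforms *)

Section Borel.
Variable R : realType.
Implicit Types (c : nat -> R) (alpha : nat -> R[i]) (M rho t T : R).

Lemma normcRe (z : R[i]) : `|z| = (complex.Re `|z|)%:C.
Proof. by rewrite normc_def. Qed.

Lemma Re_normc_ge0 (z : R[i]) : 0 <= complex.Re `|z|.
Proof. by rewrite normc_def sqrtr_ge0. Qed.

(** A positive radius of convergence in the form of a Cauchy estimate on the coefficients;
    [convergent_expbdd] and [expbdd_convergent] give the equivalence. *)
Definition expbdd alpha := exists M rho : R, 0 <= rho /\
  forall n, `|alpha n| <= (M * rho ^+ n)%:C.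

Lemma is_cvg_egf c M rho t : 0 <= rho -> (forall n, `|c n| <= M * rho ^+ n) ->
  cvgn (pseries (fun k => c k / k`!%:R) t).
Proof.
move=> rho0 cM; have M0 : 0 <= M by have := cM 0; rewrite expr0 mulr1; apply: le_trans.
apply: normed_cvg.
apply: (@series_le_cvg _ _ (fun k => M * exp_coeff (rho * `|t|) k)) => [k|k|k|].
- exact: normr_ge0.
- by rewrite mulr_ge0// exp_coeff_ge0// mulr_ge0.
- rewrite /exp_coeff/= !normrM normfV normrX (ger0_norm (ler0n _ _)) exprMn.
  rewrite -mulrA (_ : M * _ = M * rho ^+ k * (k`!%:R^-1 * `|t| ^+ k)); last by ring.
  by rewrite ler_wpM2r// mulr_ge0// ?invr_ge0// exprn_ge0.
- by have := @is_cvg_seriesZ _ _ M (is_cvg_series_exp_coeff (rho * `|t|)); exact.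
Qed.

(** The exponential generating function of [c], that is, the Borel transform of its power series. *)
Definition egf c t : R := limn (pseries (fun k => c k / k`!%:R) t).

(** Continuity comes from termwise differentiability, which asks that the series and its first two
    formal derivatives converge at a point beyond t. Differentiation only shifts [c], and a shift
    keeps the bound with M replaced by M rho. *)
Lemma continuous_egf c M rho : 0 <= rho -> (forall n, `|c n| <= M * rho ^+ n) ->
  continuous (egf c).
Proof.
move=> rho0 cM t.
have dE (d : nat -> R) : pseries_diffs (fun k => d k / k`!%:R) = fun k => d k.+1 / k`!%:R.
  by apply/funext => k; rewrite /pseries_diffs factS natrM invfM mulrCA mulVKf// pnatr_eq0.
have sM (d : nat -> R) N : (forall n, `|d n| <= N * rho ^+ n) ->
    forall n, `|d n.+1| <= N * rho * rho ^+ n.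
  by move=> dN n; rewrite -mulrA -exprS.
have := @pseries_snd_diffs R (fun k => c k / k`!%:R) (`|t| + 1) t.
rewrite !dE => /(_ (is_cvg_egf rho0 cM)) /(_ (is_cvg_egf rho0 (sM _ _ cM))).
move=> /(_ (is_cvg_egf rho0 (sM _ _ (sM _ _ cM)))).
rewrite [X in _ < X]ger0_norm ?addr_ge0// ltrDl ltr01 => /(_ isT) [dt _].
by apply: differentiable_continuous; apply/derivable1_diffP.
Qed.

Lemma expbdd_re alpha M rho : (forall n, `|alpha n| <= (M * rho ^+ n)%:C) ->
  forall n, `|complex.Re (alpha n)| <= M * rho ^+ n.
Proof. by move=> aM n; have [] := normc_leP (aM n). Qed.

Lemma expbdd_im alpha M rho : (forall n, `|alpha n| <= (M * rho ^+ n)%:C) ->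
  forall n, `|complex.Im (alpha n)| <= M * rho ^+ n.
Proof. by move=> aM n; have [] := normc_leP (aM n). Qed.

(* 'X^k goes to {t^k / k!} = l^(k+1): borel p is l times the value of p at l. *)
Definition borel (p : {poly R[i]}) : ctsfun R :=
  \sum_(k < size p) cscale p`_k (mono R k).

Lemma borelE (p : {poly R[i]}) m t : (size p <= m)%N -> 0 <= t ->
  borel p t = \sum_(0 <= k < m) p`_k * (t ^+ k / k`!%:R)%:C.
Proof.
move=> pm t0; rewrite /borel.
rewrite (big_morph (fun f : ctsfun R => f t) (id1 := 0) (op1 := +%R))//.
rewrite (eq_bigr (fun k : 'I_(size p) => p`_k * (t ^+ k / k`!%:R)%:C)); last first.
  by move=> k _; rewrite /= monoE.
rewrite -(big_mkord xpredT (fun k => p`_k * (t ^+ k / k`!%:R)%:C)).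
rewrite [RHS](big_cat_nat (leq0n _) pm)//=.
rewrite [X in _ = _ + X]big_nat_cond [X in _ = _ + X]big1 ?addr0// => k.
by rewrite andbT => /andP[kp _]; rewrite nth_default// mul0r.
Qed.

(* Tannery's argument: at each N the coefficients of P N and alpha agree below N.-1,
   and the others contribute at most the tails of two exponential series. *)
Theorem borel_cvg alpha : expbdd alpha -> exists a : ctsfun R, a 0 = alpha 0 /\
  forall P : nat -> {poly R[i]},
    (exists M rho, 0 <= rho /\ forall N k, `|(P N)`_k| <= (M * rho ^+ k)%:C) ->
    (forall N k, (k.+1 < N)%N -> (P N)`_k = alpha k) ->
    ucvg (fun N => borel (P N)) a.
Proof.
move=> [M1 [r1 [r10 aM]]].
have cre := continuous_egf r10 (expbdd_re aM).
have cim := continuous_egf r10 (expbdd_im aM).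
pose af t : R[i] := if t < 0 then 0 else
  egf (fun k => complex.Re (alpha k)) t +i* egf (fun k => complex.Im (alpha k)) t.
have afP : af \in @cts_halfline R.
  apply/cts_halflineP; split; last by move=> t t0; rewrite /af t0.
  apply/within_complexP; split; apply/subspace_continuousP => x;
  rewrite /= in_itv/= andbT => x0;
  rewrite /from_subspace.
    apply: cvg_trans; first apply: (@fmap_within_eq R (`[0, +oo[%classic : set R) R
        (nbhs x) (fun t => complex.Re (af t)) (egf (fun k => complex.Re (alpha k)))).
      by move=> t; rewrite inE/= in_itv/= andbT /af ltNge => ->.
    by rewrite /af ltNge x0/=; apply: cvg_within_filter; exact: cre.
  apply: cvg_trans; first apply: (@fmap_within_eq R (`[0, +oo[%classic : set R) R
        (nbhs x) (fun t => complex.Im (af t)) (egf (fun k => complex.Im (alpha k)))).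
    by move=> t; rewrite inE/= in_itv/= andbT /af ltNge => ->.
  by rewrite /af ltNge x0/=; apply: cvg_within_filter; exact: cim.
exists (CtsFun afP); split.
  rewrite /= /af ltxx /egf.
  have lim0 (d : nat -> R) : limn (pseries (fun k => d k / k`!%:R) 0) = d 0.
    apply: cvg_lim => //; rewrite -cvg_shiftS.
    apply: cvg_near_cst; near=> n; rewrite /pseries /series/= big_nat_recl//=.
    rewrite expr0 mulr1 fact0 divr1 big1 ?addr0// => k _.
    by rewrite expr0n/= mulr0.
  by rewrite !lim0; case: (alpha 0).
move=> P [M2 [r2 [r20 PM]]] Pa; apply/ucvgP => T e e0.
have [T0|T0] := ltP T 0.
  near=> n => t; rewrite in_itv/= => /andP[t0 tT].
  by move: (le_lt_trans (le_trans t0 tT) T0); rewrite ltxx.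
have M10 : 0 <= M1.
  by have := aM 0; rewrite expr0 mulr1 => h; rewrite -lecR; exact: (le_trans (normr_ge0 _) h).
have M20 : 0 <= M2.
  by have := PM 0 0; rewrite expr0 mulr1 => h; rewrite -lecR; exact: (le_trans (normr_ge0 _) h).
pose u k := M1 * exp_coeff (r1 * T) k + M2 * exp_coeff (r2 * T) k.
have u0 k : 0 <= u k.
  by rewrite addr_ge0// mulr_ge0// exp_coeff_ge0// mulr_ge0.
have cu : cvgn (series u).
  apply: is_cvg_seriesD.
    by have := @is_cvg_seriesZ _ _ M1 (is_cvg_series_exp_coeff (r1 * T)); exact.
  by have := @is_cvg_seriesZ _ _ M2 (is_cvg_series_exp_coeff (r2 * T)); exact.
have e20 : 0 < e / 2 by rewrite divr_gt0.
have tail : \forall n \near \oo, limn (series u) - series u n.-1 <= e / 2.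
  have : series u n.-1 @[n --> \oo] --> limn (series u).
    by rewrite -cvg_shiftS; exact: cu.
  move=> /cvgrPdist_le/(_ _ e20); apply: filterS => n; exact: le_trans (ler_norm _).
apply: filterS tail => N tailN t; rewrite in_itv/= => /andP[t0 tT].
pose S m := \sum_(0 <= k < m) alpha k * (t ^+ k / k`!%:R)%:C.
(* The polynomial is compared with finite sums [S m] of the limit series, and m goes to infinity
   afterwards, in the real and the imaginary part separately; hence e / 2 for each. *)
have key : \forall m \near \oo, `|S m - borel (P N) t| <= (e / 2)%:C.
  near=> m.
  have sm : (size (P N) <= m)%N by near: m; exact: nbhs_infty_ge.
  have Nm : (N.-1 <= m)%N by near: m; exact: nbhs_infty_ge.
  rewrite (borelE sm t0) /S -sumrB (big_cat_nat (leq0n _) Nm)/=.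
  rewrite big_nat_cond big1 ?add0r; last first.
    move=> k /andP[/andP[_ kN] _]; rewrite Pa ?subrr//.
    by move: kN; clear; case: N.
  apply: (@le_trans _ _ (\sum_(N.-1 <= k < m) u k)%:C); last first.
    rewrite lecR (le_trans _ tailN)// lerBrDl -big_cat_nat//.
    exact: (nondecreasing_cvgn_le (nondecreasing_series (fun n _ _ => u0 n))).
  rewrite rmorph_sum/= (le_trans (ler_norm_sum _ _ _))// ler_sum// => k _.
  rewrite -mulrBl normrM normc_real [`|t ^+ k / _|]ger0_norm; last first.
    by rewrite divr_ge0 ?exprn_ge0.
  apply: (@le_trans _ _ ((M1 * r1 ^+ k + M2 * r2 ^+ k)%:C * (T ^+ k / k`!%:R)%:C)).
    rewrite ler_pM//.
    - by rewrite lecR divr_ge0 ?exprn_ge0.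
    - by rewrite (le_trans (ler_normB _ _))// rmorphD/= lerD.
    - by rewrite lecR ler_wpM2r ?invr_ge0// lerXn2r.
  rewrite -rmorphM/= lecR /u /exp_coeff/= !exprMn.
  by rewrite le_eqVlt; apply/orP; left; apply/eqP; ring.
have Sre m : complex.Re (S m) = pseries (fun k => complex.Re (alpha k) / k`!%:R) t m.
  rewrite /S /pseries /series/= (big_morph (@complex.Re R) (id1 := 0) (op1 := +%R))//.
    by apply: eq_bigr => k _; case: (alpha k) => x y /=; rewrite mulr0 subr0 mulrAC mulrA.
  by case=> ? ? [].
have Sim m : complex.Im (S m) = pseries (fun k => complex.Im (alpha k) / k`!%:R) t m.
  rewrite /S /pseries /series/= (big_morph (@complex.Im R) (id1 := 0) (op1 := +%R))//.
    by apply: eq_bigr => k _; case: (alpha k) => x y /=; rewrite mulr0 add0r mulrAC mulrA.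
  by case=> ? ? [].
have lim_le (v : nat -> R) (L b : R) : v @ \oo --> L ->
    (\forall m \near \oo, `|v m - b| <= e / 2) -> `|L - b| <= e / 2.
  move=> vL vb; apply: (@cvgr_to_le _ _ _ _ (fun m => `|v m - b|)) vb.
  by apply: cvg_norm; apply: cvgB => //; exact: cvg_cst.
rewrite distrC (le_trans (normc_le_ReIm _))// lecR (splitr e) lerD//.
- rewrite (_ : complex.Re _ = egf (fun k => complex.Re (alpha k)) t -
      complex.Re (borel (P N) t)); last first.
    by rewrite /= /af ltNge t0/=; case: (borel _ _).
  apply: lim_le; first exact: (is_cvg_egf r10 (expbdd_re aM)).
  apply: filterS key => m /normc_leP[+ _]; rewrite -Sre.
  by case: (S m) (borel _ _) => ? ? [].
- rewrite (_ : complex.Im _ = egf (fun k => complex.Im (alpha k)) t -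
      complex.Im (borel (P N) t)); last first.
    by rewrite /= /af ltNge t0/=; case: (borel _ _).
  apply: lim_le; first exact: (is_cvg_egf r10 (expbdd_im aM)).
  apply: filterS key => m /normc_leP[_ +]; rewrite -Sim.
  by case: (S m) (borel _ _) => ? ? [].
Unshelve. all: by end_near. Qed.

(** At the point r / 2 inside the disc the terms tend to 0: from some N on they are at most 1, and
    the sum of the first N norms covers the others. Hence growth rate 2 / r. *)
Lemma convergent_expbdd alpha : convergent_pseries alpha -> expbdd alpha.
Proof.
move=> [r r0 /(_ (r / 2)%:C)].
have r20 : 0 < r / 2 by rewrite divr_gt0.
rewrite normc_real ltcR gtr0_norm// (_ : r / 2 < r); last by move: r0; clear; lra.
move=> /(_ isT) /cvg_series_cvg_0 a0.
have /cvgrPdist_lt/(_ 1 ltr01)[N _ hN] := a0.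
pose M := 1 + \sum_(k < N) complex.Re `|alpha k * (r / 2)%:C ^+ k|.
exists M, (r / 2)^-1; split; first by rewrite invr_ge0 ltW.
move=> n; have h : `|alpha n * (r / 2)%:C ^+ n| <= M%:C.
  have [nN|Nn] := ltnP n N; last first.
    have := hN n Nn; rewrite /= sub0r normrN => /ltW/le_trans; apply.
    by rewrite lecR lerDl sumr_ge0// => k _; exact: Re_normc_ge0.
  rewrite normcRe lecR /M (bigD1 (Ordinal nN))//= addrCA lerDl addr_ge0// sumr_ge0// => k _.
  exact: Re_normc_ge0.
rewrite exprVn; rewrite -rmorphXn/= in h.
have rn0 : 0 < (r / 2) ^+ n by rewrite exprn_gt0.
move: h; rewrite normrM normc_real (gtr0_norm rn0) => h.
rewrite -(@ler_pM2r _ ((r / 2) ^+ n)%:C) ?ltcR// (le_trans h)//.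
by rewrite -rmorphM/= mulfVK// gt_eqF.
Qed.

Lemma cvg_complex (u : nat -> R[i]) : cvgn (fun n => complex.Re (u n)) ->
  cvgn (fun n => complex.Im (u n)) -> cvgn (u : nat -> R[i]^o).
Proof.
set a := limn _; set b := limn _ => ca cb.
apply: (@cvgP _ _ ((a +i* b) : R[i]^o)); apply/cvgrPdist_lt => -[e e'].
rewrite ltcE/= => /andP[/eqP -> e0].
have e20 : 0 < e / 2 by rewrite divr_gt0.
have /cvgrPdist_lt/(_ _ e20) ha := ca.
have /cvgrPdist_lt/(_ _ e20) hb := cb.
near=> n; rewrite (le_lt_trans (normc_le_ReIm _))// ltcR (splitr e) ltrD//.
  rewrite (_ : complex.Re _ = a - complex.Re (u n)); first by near: n.
  by case: (u n).
rewrite (_ : complex.Im _ = b - complex.Im (u n)); first by near: n.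
by case: (u n).
Unshelve. all: by end_near. Qed.

Lemma expbdd_convergent alpha : expbdd alpha -> convergent_pseries alpha.
Proof.
move=> [M [rho [rho0 aM]]].
have M0 : 0 <= M.
  by have := aM 0; rewrite expr0 mulr1 => h; rewrite -lecR; exact: (le_trans (normr_ge0 _) h).
have r0 : 0 < rho + 1 by rewrite ltr_wpDl.
(* This radius makes sense for rho = 0 too, and still forces rho |z| < 1, the ratio of the
   dominating geometric series. *)
exists (rho + 1)^-1; first by rewrite invr_gt0.
move=> z zr.
set x := complex.Re `|z|.
have x1 : rho * x < 1.
  move: zr; rewrite normcRe ltcR -/x => zr; rewrite (@le_lt_trans _ _ ((rho + 1) * x))//.
    by rewrite ler_wpM2r ?lerDl// Re_normc_ge0.
  by rewrite -ltr_pdivlMl// mulr1.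
have cg : cvgn (series (geometric M (rho * x))).
  by apply: is_cvg_geometric_series; rewrite ger0_norm// mulr_ge0// Re_normc_ge0.
have bnd n : `|alpha n * z ^+ n| <= (geometric M (rho * x) n)%:C.
  rewrite normrM normrX (normcRe z) -/x /= exprMn mulrA rmorphM/= rmorphXn/=.
  by rewrite ler_wpM2r// exprn_ge0// lecR Re_normc_ge0.
have cc (p : R[i] -> R) : (forall w v, p (w + v) = p w + p v) -> p 0 = 0 ->
    (forall n, `|p (alpha n * z ^+ n)| <= geometric M (rho * x) n) ->
    cvgn (fun n => p (series (fun k => alpha k * z ^+ k) n)).
  move=> pD p0 pM.
  rewrite (_ : (fun n => _) = series (fun k => p (alpha k * z ^+ k))); last first.
    by apply/funext => n; rewrite /series/= (big_morph p pD p0).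
  apply: normed_cvg; apply: series_le_cvg cg => //= n.
  by rewrite mulr_ge0// exprn_ge0// mulr_ge0// Re_normc_ge0.
apply: cvg_complex; apply: cc => //.
- by case=> ? ? [].
- by move=> n; have [] := normc_leP (bnd n).
- by case=> ? ? [].
- by move=> n; have [] := normc_leP (bnd n).
Qed.

End Borel.

(** * The field of fractions: scalars, tau, D, convergence and series in l *)

Section OperatorField.
Variables (R : realType) (Q : fieldType) (iota : ctsfun R -> Q).
Hypothesis Qfrac : fraction_field iota.
Implicit Types (a b c d : ctsfun R) (x y : Q) (z : R[i]).

Local Notation l := (op_l iota).
Local Notation sigma := (op_scalar iota).

Lemma iotaB a b : iota (a - b) = iota a - iota b.
Proof. exact: frac_zmod Qfrac a b. Qed.

Lemma iota0 : iota 0 = 0.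
Proof. by rewrite -(subrr 0) iotaB subrr. Qed.

Lemma iotaN a : iota (- a) = - iota a.
Proof. by rewrite -sub0r iotaB iota0 sub0r. Qed.

Lemma iotaD a b : iota (a + b) = iota a + iota b.
Proof. by rewrite -{1}(opprK b) iotaB iotaN opprK. Qed.

Lemma iotaM a b : iota (conv a b) = iota a * iota b.
Proof. exact: frac_conv Qfrac a b. Qed.

Lemma iota_eq0 a : (iota a == 0) = (a == 0).
Proof. by rewrite -iota0 (inj_eq (frac_inj Qfrac)). Qed.

Lemma cst1_neq0 : cstC (1 : R[i]) != 0.
Proof.
apply/eqP => /(congr1 (fun f : ctsfun R => f 0)) /=; rewrite /cst_fun ltxx.
by move/eqP; rewrite oner_eq0.
Qed.

Lemma op_l_neq0 : l != 0.
Proof. by rewrite iota_eq0 cst1_neq0. Qed.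

(** Titchmarsh's theorem, available here because [iota] is an injective multiplicative map into a
    field. *)
Lemma conv_neq0 a b : a != 0 -> b != 0 -> conv a b != 0.
Proof. by move=> a0 b0; rewrite -iota_eq0 iotaM mulf_neq0// iota_eq0. Qed.

Lemma op_scalar_iota z f : sigma z * iota f = iota (cscale z f).
Proof. by rewrite /op_scalar mulrAC -iotaM conv_cst iotaM mulrAC mulfV ?mul1r// op_l_neq0. Qed.

Fact op_scalar_zmod : zmod_morphism sigma.
Proof.
move=> z w; rewrite /op_scalar -mulrBl -iotaB; congr (iota _ / _).
by apply/ctsfunP => t t0 /=; rewrite !fctE /cst_fun ltNge t0.
Qed.

Fact op_scalar_monoid : monoid_morphism sigma.
Proof.
split=> [|z w]; first by rewrite /op_scalar mulfV// op_l_neq0.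
rewrite {3}/op_scalar mulrA op_scalar_iota; congr (iota _ / _).
by apply/ctsfunP => t t0 /=; rewrite /cst_fun ltNge t0.
Qed.

HB.instance Definition _ := GRing.isZmodMorphism.Build _ _ sigma op_scalar_zmod.
HB.instance Definition _ := GRing.isMonoidMorphism.Build _ _ sigma op_scalar_monoid.

Lemma iota_mono k : iota (mono R k) = l ^+ k.+1.
Proof. by elim: k => [//|k IH]; rewrite exprS /= iotaM IH. Qed.

(** * The transforming operator on fractions *)

Section Transform.
Variables (q : R) (q_gt0 : 0 < q).
Local Notation tau := (op_tau iota q_gt0).
Local Notation dil := (dilate q_gt0).

Lemma dilate_eq0 a : (dil a == 0) = (a == 0).
Proof.
have d0 : dil 0 = 0 by have := dilate_zmod q_gt0 0 0; rewrite !subrr.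
by rewrite -[in LHS]d0 (inj_eq (dilate_inj (q_gt0 := q_gt0))).
Qed.

(** Independence of the chosen fraction: the cross-multiplied equality of two fractions is an
    identity between convolutions, and the dilation preserves it. *)
Lemma op_tauE a b : b != 0 -> tau (iota a / iota b) = iota (dil a) / iota (dil b).
Proof.
move=> b0; rewrite /op_tau; case: xgetP => [y _ /=|/(_ (iota (dil a) / iota (dil b)))]; last first.
  by case; exists a, b.
move=> [a' [b' [b'0 e ->]]]; apply/eqP; rewrite eqr_div ?iota_eq0 ?dilate_eq0//.
rewrite -!iotaM -!dilate_conv; apply/eqP; do 2 f_equal.
apply: (frac_inj Qfrac); rewrite !iotaM; apply/eqP.
by rewrite -eqr_div ?iota_eq0// e.
Qed.

Lemma op_tau_iota a : tau (iota a) = iota (dil a).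
Proof.
have b0 := cst1_neq0; have l0 := op_l_neq0.
rewrite -[iota a](mulfK l0) -iotaM op_tauE// dilate_conv iotaM mulfK//.
by rewrite iota_eq0 dilate_eq0.
Qed.

Fact op_tau_zmod : zmod_morphism tau.
Proof.
move=> x y; have [a [b [b0 ->]]] := frac_surj Qfrac x.
have [c [d [d0 ->]]] := frac_surj Qfrac y.
have [ib id] : iota b != 0 /\ iota d != 0 by rewrite !iota_eq0.
have [jb jd] : iota (dil b) != 0 /\ iota (dil d) != 0 by rewrite !iota_eq0 !dilate_eq0.
rewrite -mulNr addf_div// mulNr -!iotaM -iotaB !op_tauE ?conv_neq0//.
by rewrite dilate_zmod !dilate_conv iotaB !iotaM -[in RHS]mulNr addf_div// mulNr.
Qed.

Fact op_tau_monoid : monoid_morphism tau.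
Proof.
split=> [|x y].
  have := op_tauE (cstC 1) cst1_neq0.
  by rewrite !mulfV// iota_eq0 ?dilate_eq0 cst1_neq0.
have [a [b [b0 ->]]] := frac_surj Qfrac x.
have [c [d [d0 ->]]] := frac_surj Qfrac y.
by rewrite mulf_div -!iotaM !op_tauE ?conv_neq0// !dilate_conv !iotaM mulf_div.
Qed.

HB.instance Definition _ := GRing.isZmodMorphism.Build _ _ tau op_tau_zmod.
HB.instance Definition _ := GRing.isMonoidMorphism.Build _ _ tau op_tau_monoid.

Lemma op_tau_transforming : transforming_operator tau.
Proof. by split; [exact: fmorph_inj|exact: op_tau_zmod|exact: op_tau_monoid]. Qed.

Lemma dilate_cst z : dil (cstC z) = cscale q%:C (cstC z).
Proof.
apply/ctsfunP => t t0 /=; rewrite /dilate_fun /cst_fun.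
by rewrite !ltNge t0 mulr_ge0// ltW.
Qed.

Lemma op_tau_l : tau l = sigma q%:C * l.
Proof. by rewrite op_tau_iota dilate_cst -op_scalar_iota. Qed.

(** The dilation multiplies [cstC z] and [cstC 1] by the same q, which cancels in the quotient. *)
Lemma op_tau_scalar z : tau (sigma z) = sigma z.
Proof.
rewrite {1}/op_scalar op_tauE ?cst1_neq0// !dilate_cst -!op_scalar_iota.
by rewrite -mulf_div mulfV ?mul1r// fmorph_eq0 (fmorph_eq0 (real_complex R)) gt_eqF.
Qed.

End Transform.

(** * The derivations d/ds and D on fractions *)

Section Derivation.
Local Notation ds := (op_ds iota).
Local Notation D := (op_D iota).

(** For two fractions of the same element, [E1] is the cross-multiplied equality and [E2] its image
    under [mulNt] by the Leibniz rule. The cross-multiplied difference of the two quotient-rule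
    values is a combination of [E1] and [E2]. *)
Lemma op_dsE a b : b != 0 -> ds (iota a / iota b) =
  (iota (mulNt a) * iota b - iota a * iota (mulNt b)) / iota b ^+ 2.
Proof.
move=> b0; rewrite /op_ds; case: xgetP => [y _ /=|]; last first.
  move=> /(_ ((iota (mulNt a) * iota b - iota a * iota (mulNt b)) / iota b ^+ 2))[].
  by exists a, b.
move=> [a' [b' [b'0 e ->]]].
have [ib ib'] : iota b != 0 /\ iota b' != 0 by rewrite !iota_eq0.
have E1 : iota a * iota b' = iota a' * iota b by apply/eqP; rewrite -eqr_div// e.
have E2 : iota (mulNt a) * iota b' + iota a * iota (mulNt b') =
    iota (mulNt a') * iota b + iota a' * iota (mulNt b).
  rewrite -!iotaM -!iotaD -!mulNt_conv; do 2 f_equal.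
  by apply: (frac_inj Qfrac); rewrite !iotaM.
apply/eqP; rewrite eqr_div ?expf_neq0//; apply/eqP.
apply/eqP; rewrite -subr_eq0; apply/eqP.
move: (iota a) (iota b) (iota a') (iota b') (iota (mulNt a)) (iota (mulNt b))
  (iota (mulNt a')) (iota (mulNt b')) E1 E2 => A B A' B' dA dB dA' dB' E1 E2.
transitivity ((dB * B' + dB' * B) * (A * B' - A' * B) -
  B * B' * ((dA * B' + A * dB') - (dA' * B + A' * dB))); first by ring.
by rewrite E1 E2 !subrr !mulr0 subr0.
Qed.

Lemma op_ds_iota a : ds (iota a) = iota (mulNt a).
Proof.
have l0 := op_l_neq0; rewrite -[iota a](mulfK l0) -iotaM op_dsE ?cst1_neq0//.
rewrite mulNt_conv iotaD !iotaM -/l; move: l0.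
by move: l (iota a) (iota (mulNt a)) (iota (mulNt (cstC 1))) => L A dA dL L0; field.
Qed.

Lemma op_ds_derivation : derivation ds.
Proof.
split=> x y; have [a [b [b0 ->]]] := frac_surj Qfrac x;
  have [c [d [d0 ->]]] := frac_surj Qfrac y;
  have [ib id] : iota b != 0 /\ iota d != 0 by rewrite !iota_eq0.
- rewrite addf_div// -!iotaM -!iotaD !op_dsE ?conv_neq0//.
  rewrite mulNtD !mulNt_conv !iotaD !iotaM.
  move: ib id; move: (iota a) (iota b) (iota c) (iota d) (iota (mulNt a)) (iota (mulNt b))
    (iota (mulNt c)) (iota (mulNt d)) => A B C E dA dB dC dE ib id.
  by field; rewrite ib id.
- rewrite mulf_div -!iotaM !op_dsE ?conv_neq0//.
  rewrite !mulNt_conv !iotaD !iotaM.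
  move: ib id; move: (iota a) (iota b) (iota c) (iota d) (iota (mulNt a)) (iota (mulNt b))
    (iota (mulNt c)) (iota (mulNt d)) => A B C E dA dB dC dE ib id.
  by field; rewrite ib id.
Qed.

Lemma op_D_derivation : derivation D.
Proof.
have [dD dM] := op_ds_derivation; split=> x y; rewrite /op_D; first by rewrite dD mulrDr.
by rewrite dM mulrDr mulrA (mulrCA x).
Qed.

Lemma op_DD x y : D (x + y) = D x + D y.
Proof. by have [h _] := op_D_derivation; exact: h. Qed.

Lemma op_DM x y : D (x * y) = D x * y + x * D y.
Proof. by have [_ h] := op_D_derivation; exact: h. Qed.

Lemma op_D_scalar z : D (sigma z) = 0.
Proof.
rewrite /op_D {1}/op_scalar op_dsE ?cst1_neq0//.
have -> : cstC z = cscale z (cstC 1).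
  by apply/ctsfunP => t t0 /=; rewrite /cst_fun ltNge t0 mulr1.
have -> : mulNt (cscale z (cstC 1)) = cscale z (mulNt (cstC 1)).
  by apply/ctsfunP => t t0 /=; rewrite /mulNt_fun mulrCA.
by rewrite -!op_scalar_iota -!mulrA (mulrC (iota (mulNt _))) subrr mul0r mulr0.
Qed.

(** Multiplication by -t sends {1} to {-t} = - l^2; the factor - s^2 in [op_D] normalises this to
    1. *)
Lemma op_D_l : D l = 1.
Proof.
rewrite /op_D op_ds_iota (_ : mulNt (cstC 1) = - mono R 1); last first.
  apply/ctsfunP => t t0; rewrite (_ : (- mono R 1) t = - mono R 1 t)// monoE//.
  by rewrite /= /mulNt_fun /cst_fun ltNge t0/= mulr1 expr1 divr1 rmorphN.
by rewrite iotaN iota_mono mulrNN /op_s exprVn mulVf// expf_neq0// op_l_neq0.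
Qed.

End Derivation.

(** * Convergence in Q(C): uniqueness of limits and continuity of the operations *)

Section Convergence.
Implicit Types (u v : nat -> Q).

Lemma op_cvg_iota f a : ucvg f a -> op_cvg iota (fun n => iota (f n)) (iota a).
Proof.
by move=> fa; exists 1; rewrite ?oner_eq0//; exists f, a; split=> [n|//|]; rewrite ?divr1 ?mul1r.
Qed.

(** If the two denominators have ratio c / d, then c f_n = d f'_n already holds in C. Convolution is
    continuous for locally uniform convergence, so uniqueness there applies. *)
Lemma op_cvg_unique u x y : op_cvg iota u x -> op_cvg iota u y -> x = y.
Proof.
move=> [p p0 [f [a [fE fa ->]]]] [p' p'0 [f' [a' [f'E fa' ->]]]].
have [c [d [d0 cd]]] := frac_surj Qfrac (p / p').
have id : iota d != 0 by rewrite iota_eq0.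
have pE : p = p' * (iota c / iota d) by rewrite -cd mulrC divfK.
have E n : conv c (f n) = conv d (f' n).
  apply: (frac_inj Qfrac); rewrite !iotaM -fE -f'E pE.
  have c0 : iota c != 0.
    by apply: contra_neq p0 => c0; rewrite pE c0 mul0r mulr0.
  by move: (u n) (iota c) (iota d) c0 id p'0 => U C d1 c0 id p'0; field; rewrite ?c0 ?id ?p'0.
have := ucvg_unique (ucvg_conv (@ucvg_cst _ c) fa).
under eq_fun do rewrite E.
move=> /(_ _ (ucvg_conv (@ucvg_cst _ d) fa')) /(congr1 iota); rewrite !iotaM => e.
rewrite pE -!mulrA; congr (_ * _); apply: (mulfI id).
by rewrite -e mulrCA !mulrA mulfK// mulrC.
Qed.

Lemma op_cvg_cst x : op_cvg iota (fun=> x) x.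
Proof.
have [a [b [b0 xE]]] := frac_surj Qfrac x; exists (iota b)^-1.
  by rewrite invr_eq0 iota_eq0.
exists (fun=> a), a; split; last by rewrite xE mulrC.
- by move=> _; rewrite invrK xE divfK// iota_eq0.
- exact: ucvg_cst.
Qed.

Lemma op_cvgM u v x y : op_cvg iota u x -> op_cvg iota v y ->
  op_cvg iota (fun n => u n * v n) (x * y).
Proof.
move=> [p p0 [f [a [fE fa ->]]]] [p' p'0 [f' [a' [f'E fa' ->]]]].
exists (p * p'); first by rewrite mulf_neq0.
exists (fun n => conv (f n) (f' n)), (conv a a'); split.
- by move=> n; rewrite iotaM -fE -f'E mulf_div.
- exact: ucvg_conv.
- by rewrite iotaM mulrACA.
Qed.

(** The denominators c / d and c' / d' are replaced by the common one 1 / (d d'), over which the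
    numerators are d' c f and d c' f'. *)
Lemma op_cvgD u v x y : op_cvg iota u x -> op_cvg iota v y ->
  op_cvg iota (fun n => u n + v n) (x + y).
Proof.
move=> [p p0 [f [a [fE fa ->]]]] [p' p'0 [f' [a' [f'E fa' ->]]]].
have [c [d [d0 pE]]] := frac_surj Qfrac p.
have [c' [d' [d'0 p'E]]] := frac_surj Qfrac p'.
have [id id'] : iota d != 0 /\ iota d' != 0 by rewrite !iota_eq0.
exists ((iota d)^-1 * (iota d')^-1); first by rewrite mulf_neq0// invr_eq0.
exists (fun n => conv (conv d' c) (f n) + conv (conv d c') (f' n)),
  (conv (conv d' c) a + conv (conv d c') a'); split.
- move=> n; rewrite iotaD !iotaM -fE -f'E.
  rewrite -{1}(divfK p0 (u n)) -{1}(divfK p'0 (v n)).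
  move: (u n / p) (v n / p') => U V; rewrite pE p'E.
  move: (iota c) (iota c') (iota d) (iota d') id id' => C C' E E' id id'.
  by field; rewrite ?id ?id' ?oner_eq0.
- exact: (ucvgD (ucvg_conv (@ucvg_cst _ _) fa) (ucvg_conv (@ucvg_cst _ _) fa')).
- rewrite iotaD !iotaM pE p'E.
  move: (iota c) (iota c') (iota d) (iota d') id id' => C C' E E' id id'.
  by field; rewrite ?id ?id' ?oner_eq0.
Qed.

Lemma op_cvgN u x : op_cvg iota u x -> op_cvg iota (fun n => - u n) (- x).
Proof.
move=> /(op_cvgM (op_cvg_cst (- 1))); under eq_fun do rewrite mulN1r.
by rewrite mulN1r.
Qed.

Lemma op_cvg_tau (q : R) (q_gt0 : 0 < q) u x : op_cvg iota u x ->
  op_cvg iota (fun n => op_tau iota q_gt0 (u n)) (op_tau iota q_gt0 x).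
Proof.
move=> [p p0 [f [a [fE fa ->]]]]; rewrite rmorphM/= op_tau_iota.
have : op_cvg iota (fun n => iota (dilate q_gt0 (f n))) (iota (dilate q_gt0 a)).
  by apply: op_cvg_iota; exact: (ucvg_dilate fa).
move=> /(op_cvgM (op_cvg_cst (op_tau iota q_gt0 p))); congr op_cvg; apply/funext => n.
by rewrite -op_tau_iota -fE -rmorphM/= mulrC divfK.
Qed.

(** With u_n = p f_n, the product rule leaves f_n and [mulNt] f_n, both convergent in C, multiplied
    by fixed elements of the field. *)
Lemma op_cvg_D u x : op_cvg iota u x ->
  op_cvg iota (fun n => op_D iota (u n)) (op_D iota x).
Proof.
move=> [p p0 [f [a [fE fa ->]]]].
have Di b : op_D iota (iota b) = - op_s iota ^+ 2 * iota (mulNt b).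
  by rewrite /op_D op_ds_iota.
have h : op_cvg iota (fun n => op_D iota (p * iota (f n))) (op_D iota (p * iota a)).
  rewrite op_DM Di; under eq_fun do rewrite op_DM Di.
  apply: op_cvgD; apply: op_cvgM; rewrite ?Di; try exact: op_cvg_cst.
    exact: op_cvg_iota.
  apply: op_cvgM; first exact: op_cvg_cst.
  by apply: op_cvg_iota; exact: (ucvg_mulNt fa).
by move: h; congr op_cvg; apply/funext => n; rewrite -fE mulrC divfK.
Qed.

End Convergence.

(** * Series in l as limits of polynomials in l *)

Section PowerSeries.
Implicit Types (alpha beta gamma : nat -> R[i]) (p : {poly R[i]}).

Definition peval p : Q := (map_poly sigma p).[l].

Lemma pevalE p m : (size p <= m)%N ->
  peval p = \sum_(0 <= k < m) sigma p`_k * l ^+ k.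
Proof.
move=> pm; rewrite /peval (horner_coef_wide _ (n := m)) ?size_map_poly// big_mkord.
by apply: eq_bigr => k _; rewrite coef_map.
Qed.

Lemma pevalM p1 p2 : peval (p1 * p2) = peval p1 * peval p2.
Proof. by rewrite /peval rmorphM hornerM. Qed.

Lemma pevalB p1 p2 : peval (p1 - p2) = peval p1 - peval p2.
Proof. by rewrite /peval rmorphB hornerD hornerN. Qed.

Lemma peval_borel p : peval p = l^-1 * iota (borel p).
Proof.
rewrite (pevalE (leqnn _)) big_mkord /borel.
rewrite (big_morph iota iotaD iota0) mulr_sumr; apply: eq_bigr => k _.
by rewrite -op_scalar_iota iota_mono exprS [RHS]mulrCA mulKf// op_l_neq0.
Qed.

Lemma op_D_peval p : op_D iota (peval p) = peval p^`().
Proof.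
elim/poly_ind: p => [|p c IH].
  by rewrite /peval deriv0 map_poly0 horner0 -(rmorph0 sigma) op_D_scalar rmorph0.
rewrite derivD derivC addr0 derivM derivX mulr1 /peval !(rmorphD, rmorphM)/=.
rewrite map_polyX map_polyC !hornerE -/(peval p) -/(peval p^`()).
by rewrite op_DD op_DM op_D_scalar op_D_l addr0 IH mulr1.
Qed.

Lemma op_tau_peval (q : R) (q_gt0 : 0 < q) p m : (size p <= m)%N ->
  op_tau iota q_gt0 (peval p) = peval (\poly_(k < m) (p`_k * q%:C ^+ k)).
Proof.
move=> pm; rewrite (pevalE pm) (pevalE (size_poly _ _)) !big_mkord rmorph_sum/=.
apply: eq_bigr => k _; rewrite coef_poly ltn_ord rmorphM rmorphXn/=.
by rewrite op_tau_scalar op_tau_l rmorphM rmorphXn exprMn mulrA.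
Qed.

Definition ptrunc alpha N : {poly R[i]} := \poly_(k < N) alpha k.

Lemma peval_ptrunc alpha N :
  peval (ptrunc alpha N) = \sum_(0 <= n < N) sigma (alpha n) * l ^+ n.
Proof.
rewrite (pevalE (size_poly _ _)) !big_mkord; apply: eq_bigr => k _.
by rewrite coef_poly ltn_ord.
Qed.

Lemma op_lseriesE alpha x :
  op_lseries iota alpha x <-> op_cvg iota (fun N => peval (ptrunc alpha N)) x.
Proof.
by rewrite /op_lseries /op_series; under [in X in _ <-> X]eq_fun do rewrite peval_ptrunc.
Qed.

(* k.+1 < N rather than k < N accommodates the derivatives of partial sums. *)
Definition approximants alpha (P : nat -> {poly R[i]}) :=
  (exists M rho : R, 0 <= rho /\ forall N k, `|(P N)`_k| <= (M * rho ^+ k)%:C) /\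
  (forall N k, (k.+1 < N)%N -> (P N)`_k = alpha k).

Lemma ptrunc_le alpha (M rho : R) : 0 <= rho -> (forall n, `|alpha n| <= (M * rho ^+ n)%:C) ->
  forall N k, `|(ptrunc alpha N)`_k| <= (M * rho ^+ k)%:C.
Proof.
move=> rho0 aM N k; rewrite coef_poly; case: ifP => // _; rewrite normr0.
exact: le_trans (normr_ge0 _) (aM k).
Qed.

Lemma approximants_ptrunc alpha : expbdd alpha -> approximants alpha (ptrunc alpha).
Proof.
move=> [M [rho [rho0 aM]]]; split; first by exists M, rho; split=> //; exact: ptrunc_le.
by move=> N k kN; rewrite coef_poly (ltn_trans (ltnSn k) kN).
Qed.

(** One limit, [l^-1 * iota a] with [a] the entire function of [borel_cvg], serves all approximants.
    The middle clause comes from [a 0 = alpha 0]; it starts the induction for uniqueness of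
    coefficients. *)
Lemma op_lseries_ex alpha : expbdd alpha -> exists x, [/\ op_lseries iota alpha x,
  x = 0 -> alpha 0 = 0 &
  forall P, approximants alpha P -> op_cvg iota (fun N => peval (P N)) x].
Proof.
move=> ba; have [a [a0 aP]] := borel_cvg ba.
have h P : approximants alpha P -> op_cvg iota (fun N => peval (P N)) (l^-1 * iota a).
  move=> [P1 P2]; under eq_fun do rewrite peval_borel.
  apply: op_cvgM; first exact: op_cvg_cst.
  by apply: op_cvg_iota; exact: aP.
exists (l^-1 * iota a); split=> //.
  by apply/op_lseriesE; apply: h; exact: approximants_ptrunc.
move=> /eqP; rewrite mulf_eq0 invr_eq0 (negbTE op_l_neq0) iota_eq0/= => /eqP a00.
by rewrite -a0 a00.
Qed.

(** Replaces partial sums by whatever polynomials an operation produces: their limit is still the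
    sum of the series. *)
Lemma approximants_lseries alpha P x : expbdd alpha -> approximants alpha P ->
  op_cvg iota (fun N => peval (P N)) x -> op_lseries iota alpha x.
Proof.
move=> ba aP Px; have [y [ay _ yP]] := op_lseries_ex ba.
by rewrite (op_cvg_unique Px (yP _ aP)).
Qed.

Definition cauchy_prod alpha beta n := \sum_(k < n.+1) alpha k * beta (n - k)%N.
Definition pseries_deriv alpha n := n.+1%:R * alpha n.+1.

Lemma approximantsM alpha beta : expbdd alpha -> expbdd beta ->
  approximants (cauchy_prod alpha beta) (fun N => ptrunc alpha N * ptrunc beta N).
Proof.
move=> [M1 [r1 [r10 aM]]] [M2 [r2 [r20 bM]]]; split; last first.
  move=> N k kN; rewrite coefM; apply: eq_bigr => j _.
  rewrite !coef_poly (leq_ltn_trans (leq_subr _ _) (ltn_trans (ltnSn k) kN)).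
  by rewrite (leq_ltn_trans _ (ltn_trans (ltnSn k) kN))// -ltnS.
exists (M1 * M2), (r1 + r2); split; first by rewrite addr_ge0.
have M0 (M r : R) (g : nat -> R[i]) : (forall n, `|g n| <= (M * r ^+ n)%:C) -> 0 <= M.
  move=> /(_ 0); rewrite expr0 mulr1 => h; rewrite -lecR; exact: (le_trans (normr_ge0 _) h).
have M10 := M0 _ _ _ aM; have M20 := M0 _ _ _ bM.
move=> N k; rewrite coefM (le_trans (ler_norm_sum _ _ _))//.
apply: (@le_trans _ _ (\sum_(j < k.+1) M1 * M2 * (r1 ^+ j * r2 ^+ (k - j)))%:C).
  rewrite rmorph_sum/= ler_sum// => j _; rewrite normrM mulrACA rmorphM/=.
  by rewrite ler_pM//; exact: ptrunc_le.
(* The binomial coefficients are at least 1, so the sum of the r1^j r2^(k - j) is at most (r1 +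
   r2)^k. *)
rewrite lecR -mulr_sumr ler_wpM2l ?mulr_ge0// addrC exprDn ler_sum// => j _.
rewrite mulrC -[leLHS]mulr1n ler_wpMn2l ?mulr_ge0 ?exprn_ge0//.
by rewrite bin_gt0 -ltnS.
Qed.

Lemma approximantsB alpha beta : expbdd alpha -> expbdd beta ->
  approximants (fun n => alpha n - beta n) (fun N => ptrunc alpha N - ptrunc beta N).
Proof.
move=> [M1 [r1 [r10 aM]]] [M2 [r2 [r20 bM]]]; split; last first.
  by move=> N k kN; rewrite coefB !coef_poly (ltn_trans (ltnSn k) kN).
have M0 (M r : R) (g : nat -> R[i]) : (forall n, `|g n| <= (M * r ^+ n)%:C) -> 0 <= M.
  move=> /(_ 0); rewrite expr0 mulr1 => h; rewrite -lecR; exact: (le_trans (normr_ge0 _) h).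
have M10 := M0 _ _ _ aM; have M20 := M0 _ _ _ bM.
exists (M1 + M2), (r1 + r2); split; first by rewrite addr_ge0.
move=> N k; rewrite coefB (le_trans (ler_normB _ _))// mulrDl rmorphD/= lerD//.
  rewrite (le_trans (ptrunc_le r10 aM N k))// lecR ler_wpM2l// lerXn2r ?nnegrE ?addr_ge0//.
  by rewrite lerDl.
rewrite (le_trans (ptrunc_le r20 bM N k))// lecR ler_wpM2l// lerXn2r ?nnegrE ?addr_ge0//.
by rewrite lerDr.
Qed.

Lemma approximants_deriv alpha : expbdd alpha ->
  approximants (pseries_deriv alpha) (fun N => (ptrunc alpha N)^`()).
Proof.
move=> [M [r [r0 aM]]]; split; last first.
  by move=> N k kN; rewrite coef_deriv coef_poly kN /pseries_deriv mulr_natl.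
have M0 : 0 <= M.
  by have := aM 0; rewrite expr0 mulr1 => h; rewrite -lecR; exact: (le_trans (normr_ge0 _) h).
(* By k + 1 <= 2^k, (k + 1) M r^(k + 1) <= M r (2 r)^k. *)
exists (M * r), (2 * r); split; first by rewrite mulr_ge0.
move=> N k; rewrite coef_deriv normrMn.
apply: (@le_trans _ _ ((M * r ^+ k.+1)%:C *+ k.+1)).
  by rewrite lerMn2r ptrunc_le ?orbT.
rewrite -rmorphMn/= lecR exprS exprMn -mulr_natr -!mulrA.
rewrite !ler_wpM2l// mulrC ler_wpM2r ?exprn_ge0// -natrX ler_nat.
exact: ltn_expl.
Qed.

(** Each [alpha n] is itself a coefficient of [P n.+2], so the bound for a derived series need not
    be proved twice. *)
Lemma approximants_expbdd alpha P : approximants alpha P -> expbdd alpha.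
Proof.
move=> [[M [rho [rho0 PM]]] Pa]; exists M, rho; split=> // n.
by rewrite -(Pa n.+2)// ltnSn.
Qed.

Lemma expbdd_dilate alpha (q : R) : 0 <= q -> expbdd alpha ->
  expbdd (fun n => alpha n * q%:C ^+ n).
Proof.
move=> q0 [M [r [r0 aM]]]; exists M, (r * q); split; first by rewrite mulr_ge0.
move=> n; rewrite normrM -rmorphXn/= normc_real [`|q ^+ n|]ger0_norm ?exprn_ge0//.
by rewrite exprMn mulrA rmorphM/= ler_wpM2r// lecR exprn_ge0.
Qed.

Lemma op_lseriesM alpha beta x y : expbdd alpha -> expbdd beta ->
  op_lseries iota alpha x -> op_lseries iota beta y ->
  op_lseries iota (cauchy_prod alpha beta) (x * y).
Proof.
move=> ba bb ax By; have ab := approximantsM ba bb.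
apply: (approximants_lseries (approximants_expbdd ab) ab).
under eq_fun do rewrite pevalM.
by apply: op_cvgM; apply/op_lseriesE.
Qed.

Lemma op_lseriesB alpha beta x y : expbdd alpha -> expbdd beta ->
  op_lseries iota alpha x -> op_lseries iota beta y ->
  op_lseries iota (fun n => alpha n - beta n) (x - y).
Proof.
move=> ba bb ax By; have ab := approximantsB ba bb.
apply: (approximants_lseries (approximants_expbdd ab) ab).
under eq_fun do rewrite pevalB.
by apply: op_cvgD; [|apply: op_cvgN]; apply/op_lseriesE.
Qed.

Lemma op_lseries_D alpha x : expbdd alpha -> op_lseries iota alpha x ->
  op_lseries iota (pseries_deriv alpha) (op_D iota x).
Proof.
move=> ba ax; have ab := approximants_deriv ba.
apply: (approximants_lseries (approximants_expbdd ab) ab).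
by under eq_fun do rewrite -op_D_peval; apply: op_cvg_D; apply/op_lseriesE.
Qed.

(** D maps the partial sum over n < N exactly to the sum over 1 <= n < N of the derived terms, so
    continuity of D concludes. *)
Lemma op_series_D alpha x : op_lseries iota alpha x ->
  op_series iota 1 (fun n => sigma (n%:R * alpha n) * l ^+ n.-1) (op_D iota x).
Proof.
move=> /op_lseriesE/op_cvg_D; rewrite /op_series; congr op_cvg; apply/funext => N.
rewrite op_D_peval (pevalE (m := N.-1)); last first.
  apply/leq_sizeP => j jN; rewrite coef_deriv coef_poly ifF ?mul0rn//.
  by apply/negbTE; move: jN; case: N => //= N; rewrite -leqNgt ltnS.
rewrite big_add1; apply: eq_big_nat => k /andP[_ kN].
rewrite coef_deriv coef_poly ifT ?mulr_natl//.
by move: kN; case: N.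
Qed.

Lemma op_lseries_tau (q : R) (q_gt0 : 0 < q) alpha x : expbdd alpha ->
  op_lseries iota alpha x ->
  op_lseries iota (fun n => alpha n * q%:C ^+ n) (op_tau iota q_gt0 x).
Proof.
move=> ba /op_lseriesE/(op_cvg_tau q_gt0) ax; apply/op_lseriesE.
move: ax; congr op_cvg; apply/funext => N.
rewrite (op_tau_peval _ (size_poly _ _)); congr peval; apply/polyP => k.
by rewrite !coef_poly; case: (k < N)%N.
Qed.

Definition pone (n : nat) : R[i] := (n == 0%N)%:R.

Lemma expbdd_one : expbdd pone.
Proof.
exists 1, 1; split=> // n; rewrite expr1n mulr1 rmorph1.
by rewrite /pone; case: (n == 0%N); rewrite ?normr1 ?normr0.
Qed.

Lemma op_lseries_one : op_lseries iota pone 1.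
Proof.
apply: (approximants_lseries (P := fun=> 1) expbdd_one).
  split=> [|N k _]; last by rewrite coef1.
  have [M [r [r0 h]]] := expbdd_one.
  by exists M, r; split=> // N k; rewrite coef1; exact: h.
have -> : peval 1 = 1 by rewrite /peval rmorph1 hornerC.
exact: op_cvg_cst.
Qed.

Lemma op_lseries_coef0 alpha x : expbdd alpha -> op_lseries iota alpha x -> x = 0 ->
  forall n, alpha n = 0.
Proof.
move=> + + x0 n; rewrite {}x0; elim: n alpha => [|n IH] alpha ba ax.
  have [y [ay y0 _]] := op_lseries_ex ba.
  by apply: y0; rewrite (op_cvg_unique ay ax).
have D0 : op_D iota 0 = 0 by rewrite -(rmorph0 sigma) op_D_scalar rmorph0.
have := op_lseries_D ba ax.
rewrite D0 => /(IH _ (approximants_expbdd (approximants_deriv ba)))/eqP.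
by rewrite mulf_eq0 pnatr_eq0/= => /eqP.
Qed.

Lemma op_lseries_inj alpha beta x : expbdd alpha -> expbdd beta ->
  op_lseries iota alpha x -> op_lseries iota beta x -> alpha =1 beta.
Proof.
move=> ba bb ax bx n; apply/eqP; rewrite -subr_eq0; apply/eqP.
apply: (op_lseries_coef0 (alpha := fun n => alpha n - beta n) _ (op_lseriesB ba bb ax bx)).
  exact: approximants_expbdd (approximantsB ba bb).
by rewrite subrr.
Qed.

End PowerSeries.

End OperatorField.

(** * Formal Laurent series as a DT field *)

Section LaurentDT.
Variable F : fieldType.
Implicit Types (c d : laurent F) (a b : nat -> F) (q : F).

(** In the Cauchy product, the weights M + j and N + (k - j) produced by the two terms of the
    product rule add up to the weight M + N + k of the whole. *)
Lemma laurent_deriv_derivation : derivation (@laurent_deriv F).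
Proof.
split=> c d; first by apply: laurentP => n /=; rewrite !fctE mulrDr.
have [M cM] := laurent_bound c; have [N dN] := laurent_bound d.
have c'M : vanish_below (laurent_deriv c) (M - 1).
  by move=> n nM; rewrite /= cM ?mulr0//; lia.
have d'N : vanish_below (laurent_deriv d) (N - 1).
  by move=> n nN; rewrite /= dN ?mulr0//; lia.
have cdMN := lmul_fun0 cM dN.
apply: laurentP; apply: (@vanish_ext _ _ _ (M + N - 1)).
- move=> n nMN; rewrite (_ : laurent_deriv (c * d) n = (n + 1)%:~R * lmul_fun c d (n + 1))//.
  by rewrite cdMN ?mulr0//; lia.
- move=> n nMN.
  rewrite (_ : _ n = lmul_fun (laurent_deriv c) d n + lmul_fun c (laurent_deriv d) n)//.
  by rewrite (lmul_fun0 c'M dN) ?(lmul_fun0 cM d'N) ?addr0//; lia.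
move=> k.
transitivity ((M + N + k%:Z)%:~R * lmul_fun c d (M + N + k%:Z)).
  by rewrite /= (_ : M + N - 1 + k%:Z + 1 = M + N + k%:Z)//; lia.
transitivity (lmul_fun (laurent_deriv c) d (M - 1 + N + k%:Z) +
    lmul_fun c (laurent_deriv d) (M + (N - 1) + k%:Z)); last first.
  rewrite (_ : M - 1 + N + k%:Z = M + N - 1 + k%:Z); last by lia.
  by rewrite (_ : M + (N - 1) + k%:Z = M + N - 1 + k%:Z)//; lia.
rewrite (lmul_funE cM dN) (lmul_funE c'M dN) (lmul_funE cM d'N) -big_split mulr_sumr.
apply: eq_bigr => j _ /=.
rewrite (_ : M - 1 + j%:Z + 1 = M + j%:Z); last by lia.
rewrite (_ : N - 1 + (k - j)%N%:Z + 1 = N + (k - j)%N%:Z); last by lia.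
rewrite -mulrA [X in _ = _ + X]mulrCA -mulrDl -intrD.
by congr (_%:~R * _); have := ltn_ord j; lia.
Qed.

Lemma laurent_dilate_transforming q : q != 0 ->
  transforming_operator (laurent_dilate q).
Proof.
move=> q0; split.
- move=> c d /(congr1 (fun e : laurent F => (e : int -> F))) /= cd.
  apply: laurentP => n; have := congr1 (fun e : int -> F => e n) cd.
  by apply: mulIf; rewrite expfz_neq0.
- by move=> c d; apply: laurentP => n /=; rewrite !fctE mulrBl.
split.
  apply: laurentP => n /=; rewrite /lone_fun; case: eqP => [->|_]; last by rewrite mul0r.
  by rewrite expr0z mulr1.
move=> c d.
have [M cM] := laurent_bound c; have [N dN] := laurent_bound d.
have c'M : vanish_below (laurent_dilate q c) M by move=> n nM; rewrite /= cM ?mul0r.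
have d'N : vanish_below (laurent_dilate q d) N by move=> n nN; rewrite /= dN ?mul0r.
have cdMN := lmul_fun0 cM dN.
apply: laurentP; apply: (@vanish_ext _ _ _ (M + N)).
- by move=> n nMN; rewrite /= cdMN ?mul0r.
- exact: lmul_fun0 c'M d'N.
move=> k; rewrite /= (lmul_funE cM dN) (lmul_funE c'M d'N) mulr_suml.
apply: eq_bigr => j _ /=; rewrite mulrACA -expfzDr//; congr (_ * _ ^ _).
by have := ltn_ord j; lia.
Qed.

Lemma laurent_of_pseries_inj a b :
  laurent_of_pseries a = laurent_of_pseries b -> a =1 b.
Proof.
move=> /(congr1 (fun c : laurent F => (c : int -> F))) /= ab n.
by have := congr1 (fun c : int -> F => c n) ab.
Qed.

Lemma eq_laurent_of_pseries a b : a =1 b -> laurent_of_pseries a = laurent_of_pseries b.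
Proof. by move=> /funext ->. Qed.

Lemma laurent_of_pseriesB a b : laurent_of_pseries (fun n => a n - b n) =
  laurent_of_pseries a - laurent_of_pseries b.
Proof. by apply: laurentP => -[n|n]//=; rewrite !fctE/= subrr. Qed.

Lemma laurent_of_pseries1 : laurent_of_pseries (fun n => (n == 0%N)%:R) = 1 :> laurent F.
Proof. by apply: laurentP => -[n|n]. Qed.

Lemma laurent_of_pseriesM a b :
  laurent_of_pseries (fun n => \sum_(k < n.+1) a k * b (n - k)%N) =
  laurent_of_pseries a * laurent_of_pseries b.
Proof.
have v (e : nat -> F) : vanish_below (laurent_of_pseries e) 0 by case.
apply: laurentP; apply: (@vanish_ext _ _ _ (0 + 0)).
- by rewrite addr0; exact: v.
- exact: lmul_fun0.
move=> k; rewrite [RHS](lmul_funE (v a) (v b)) !add0r /=.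
by apply: eq_bigr.
Qed.

Lemma laurent_of_pseries_deriv a :
  laurent_of_pseries (fun n => n.+1%:R * a n.+1) = laurent_deriv (laurent_of_pseries a).
Proof.
apply: laurentP => -[n|n] /=; first by rewrite -PoszD addn1.
(* At index -1 the coefficient read is [a 0], and the weight n + 1 = 0 kills it; at lower indices
   the coefficient itself is 0. *)
case: n => [|n]; first by rewrite mul0r.
rewrite (_ : Negz n.+1 + 1 = Negz n) ?mulr0//; lia.
Qed.

Lemma laurent_of_pseries_dilate q a :
  laurent_of_pseries (fun n => a n * q ^+ n) = laurent_dilate q (laurent_of_pseries a).
Proof. by apply: laurentP => -[n|n] //=; rewrite mul0r. Qed.

End LaurentDT.

(** * Extending a partial isomorphism, given as a relation, to fractions *)

Section FractionGraph.
Variables (K L : fieldType) (E : K -> L -> Prop).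
Hypotheses (E1 : E 1 1)
  (EB : forall a b a' b', E a a' -> E b b' -> E (a - b) (a' - b'))
  (EM : forall a b a' b', E a a' -> E b b' -> E (a * b) (a' * b'))
  (Einj : forall a b a' b', E a a' -> E b b' -> a = b <-> a' = b').

(** [E] plays the role of the graph of an injective ring homomorphism on a subring; [Einj] says both
    that it is single-valued and that it is injective. That b' is nonzero follows from b != 0 by
    [graph_neq0]. *)
Definition frac_graph x y := exists a b a' b',
  [/\ E a a', E b b', b != 0, x = a / b & y = a' / b'].

Lemma graph_neq0 b b' : E b b' -> (b != 0) = (b' != 0).
Proof.
have E0 : E 0 0 by have := EB E1 E1; rewrite !subrr.
by move=> bb'; congr negb; apply/eqP/eqP; apply Einj.
Qed.

Lemma frac_graph_inj x y x' y' : frac_graph x x' -> frac_graph y y' -> x = y <-> x' = y'.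
Proof.
move=> [a [b [a' [b' [aa bb b0 -> ->]]]]] [c [d [c' [d' [cc dd d0 -> ->]]]]].
have [b'0 d'0] : b' != 0 /\ d' != 0 by rewrite -(graph_neq0 bb) -(graph_neq0 dd).
have := Einj (EM aa dd) (EM cc bb); rewrite !(rwP eqP) !eqr_div//.
Qed.

Lemma frac_graphE a a' : E a a' -> frac_graph a a'.
Proof. by move=> aa; exists a, 1, a', 1; rewrite !divr1 oner_eq0. Qed.

Lemma frac_graphB x y x' y' : frac_graph x x' -> frac_graph y y' ->
  frac_graph (x - y) (x' - y').
Proof.
move=> [a [b [a' [b' [aa bb b0 -> ->]]]]] [c [d [c' [d' [cc dd d0 -> ->]]]]].
have [b'0 d'0] : b' != 0 /\ d' != 0 by rewrite -(graph_neq0 bb) -(graph_neq0 dd).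
exists (a * d - c * b), (b * d), (a' * d' - c' * b'), (b' * d').
split; [by apply: EB; exact: EM|exact: EM|exact: mulf_neq0| |].
- by rewrite -mulNr addf_div// mulNr.
- by rewrite -mulNr addf_div// mulNr.
Qed.

Lemma frac_graphM x y x' y' : frac_graph x x' -> frac_graph y y' ->
  frac_graph (x * y) (x' * y').
Proof.
move=> [a [b [a' [b' [aa bb b0 -> ->]]]]] [c [d [c' [d' [cc dd d0 -> ->]]]]].
exists (a * c), (b * d), (a' * c'), (b' * d').
by split; [exact: EM|exact: EM|exact: mulf_neq0|rewrite mulf_div|rewrite mulf_div].
Qed.

Lemma frac_graphV x x' : frac_graph x x' -> frac_graph x^-1 x'^-1.
Proof.
move=> [a [b [a' [b' [aa bb b0 -> ->]]]]].
(* For a = 0 both inverses take the default value 0, and the pair (0, 0) lies in the graph. *)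
have := graph_neq0 aa; have [->|a0] := eqVneq a 0 => /esym a'0.
  rewrite mul0r; move/negbFE/eqP : a'0 => ->; rewrite mul0r !invr0.
  by have := frac_graphE (EB E1 E1); rewrite !subrr.
by exists b, a, b', a'; rewrite !invf_div; split.
Qed.

(** The product rule for (a / b) b = a, solved for D (a / b). *)
Lemma derivation_div (M : fieldType) (D : M -> M) (a b : M) : derivation D -> b != 0 ->
  D (a / b) = (D a * b - a * D b) / (b * b).
Proof.
move=> [_ DM] b0; have := DM (a / b) b; rewrite divfK// => ->.
by move: (D (a / b)) (D b) => x y; field.
Qed.

Lemma frac_graph_derivation (D : K -> K) (D' : L -> L) : derivation D -> derivation D' ->
  (forall a a', E a a' -> E (D a) (D' a')) ->
  forall x x', frac_graph x x' -> frac_graph (D x) (D' x').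
Proof.
move=> dD dD' ED x x' [a [b [a' [b' [aa bb b0 -> ->]]]]].
rewrite !derivation_div// -?(graph_neq0 bb)//.
exists (D a * b - a * D b), (b * b), (D' a' * b' - a' * D' b'), (b' * b').
split=> //; [|exact: EM|exact: mulf_neq0].
by apply: EB; apply: EM => //; exact: ED.
Qed.

Lemma transforming_operatorV (M : fieldType) (tau : M -> M) (a b : M) :
  transforming_operator tau -> b != 0 -> tau (a / b) = tau a / tau b /\ tau b != 0.
Proof.
move=> [tau_inj tauB [_ tauM]] b0.
have tb0 : tau b != 0.
  have t0 : tau 0 = 0 by have := tauB 0 0; rewrite !subrr.
  by rewrite -t0 (inj_eq tau_inj).
by split=> //; apply: (mulIf tb0); rewrite -tauM !divfK.
Qed.

Lemma frac_graph_transforming (tau : K -> K) (tau' : L -> L) :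
  transforming_operator tau -> transforming_operator tau' ->
  (forall a a', E a a' -> E (tau a) (tau' a')) ->
  forall x x', frac_graph x x' -> frac_graph (tau x) (tau' x').
Proof.
move=> ttau ttau' Etau x x' [a [b [a' [b' [aa bb b0 -> ->]]]]].
have b'0 : b' != 0 by rewrite -(graph_neq0 bb).
have [-> tb0] := transforming_operatorV a ttau b0.
have [-> _] := transforming_operatorV a' ttau' b'0.
by exists (tau a), (tau b), (tau' a'), (tau' b'); split => //; exact: Etau.
Qed.

End FractionGraph.

(** * The coefficient map on C{l} and the embedding of its quotient field *)

Section ConvergentSeries.
Variables (R : realType) (Q : fieldType) (iota : ctsfun R -> Q).
Hypothesis Qfrac : fraction_field iota.
Implicit Types (x y : Q) (u v : laurent R[i]).

(* The graph of the coefficient map from C{l} to C((l)). *)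
Definition series_graph x u := exists alpha : nat -> R[i],
  [/\ expbdd alpha, op_lseries iota alpha x & u = laurent_of_pseries alpha].

Lemma op_ClP x : op_Cl iota x <-> exists u, series_graph x u.
Proof.
split=> [[alpha ca ax]|[_ [alpha [ba ax _]]]].
  by exists (laurent_of_pseries alpha), alpha; split=> //; exact: convergent_expbdd.
by exists alpha => //; exact: expbdd_convergent.
Qed.

Lemma series_graph1 : series_graph 1 1.
Proof.
exists (@pone R); split; [exact: expbdd_one|exact: op_lseries_one|].
by rewrite -laurent_of_pseries1.
Qed.

Lemma series_graphB x y u v : series_graph x u -> series_graph y v ->
  series_graph (x - y) (u - v).
Proof.
move=> [a [ba ax ->]] [b [bb bx ->]]; exists (fun n => a n - b n).
split; last by rewrite laurent_of_pseriesB.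
  exact: approximants_expbdd (approximantsB ba bb).
exact: op_lseriesB.
Qed.

Lemma series_graphM x y u v : series_graph x u -> series_graph y v ->
  series_graph (x * y) (u * v).
Proof.
move=> [a [ba ax ->]] [b [bb bx ->]]; exists (cauchy_prod a b).
split; last by rewrite -laurent_of_pseriesM.
  exact: approximants_expbdd (approximantsM ba bb).
exact: op_lseriesM.
Qed.

(** From left to right this is uniqueness of coefficients, from right to left uniqueness of
    limits. *)
Lemma series_graph_inj x y u v : series_graph x u -> series_graph y v ->
  x = y <-> u = v.
Proof.
move=> [a [ba ax ->]] [b [bb bx ->]]; split=> [xy|/laurent_of_pseries_inj/funext ab].
  apply: eq_laurent_of_pseries; apply: (op_lseries_inj Qfrac ba bb ax).
  by rewrite xy.
by move: bx; rewrite -ab; exact: (op_cvg_unique Qfrac ax).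
Qed.

Lemma series_graph_D x u : series_graph x u ->
  series_graph (op_D iota x) (laurent_deriv u).
Proof.
move=> [a [ba ax ->]]; exists (pseries_deriv a); split.
- exact: approximants_expbdd (approximants_deriv ba).
- exact: op_lseries_D.
- by rewrite -laurent_of_pseries_deriv.
Qed.

Lemma series_graph_tau (q : R) (q_gt0 : 0 < q) x u : series_graph x u ->
  series_graph (op_tau iota q_gt0 x) (laurent_dilate q%:C u).
Proof.
move=> [a [ba ax ->]]; exists (fun n => a n * q%:C ^+ n); split.
- exact: expbdd_dilate (ltW q_gt0) ba.
- exact: op_lseries_tau.
- by rewrite laurent_of_pseries_dilate.
Qed.

Local Notation QE := (frac_graph series_graph).

Lemma op_QClP x : op_QCl iota x <-> exists u, QE x u.
Proof.
split=> [[a [b [/op_ClP[u au] /op_ClP[v bv] b0 ->]]]|[_ [a [b [u [v [au bv b0 -> _]]]]]]].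
  by exists (u / v), a, b, u, v.
by exists a, b; split=> //; apply/op_ClP; [exists u|exists v].
Qed.

(** The values of an induced embedding on Q(C{l}) are forced, so a claim about every such phi
    becomes a claim about the relation. *)
Lemma induced_embeddingP (phi : Q -> laurent R[i]) : induced_embedding iota phi <->
  forall x u, QE x u -> phi x = u.
Proof.
have Einj := series_graph_inj; have E1 := series_graph1.
have EB := series_graphB; have EM := series_graphM.
split=> [[[phi1 phiB phiM phi_inj] phiE]|phiE].
  have phiS x u : series_graph x u -> phi x = u.
    by move=> [a [ba ax ->]]; apply: phiE => //; exact: expbdd_convergent.
  have QS x u : series_graph x u -> op_QCl iota x.
    by move=> xu; apply/op_QClP; exists u; exact: frac_graphE.
  move=> x u xu; have xQ : op_QCl iota x by apply/op_QClP; exists u.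
  move: xu xQ => [a [b [a' [b' [aa bb b0 -> ->]]]]] xQ.
  have b'0 : b' != 0 by rewrite -(graph_neq0 E1 EB Einj bb).
  (* Division is avoided: phi is multiplicative on Q(C{l}), which contains both a / b and b. *)
  apply: (mulIf b'0); rewrite divfK// -{1}(phiS _ _ bb) -phiM ?inE//; last exact: QS bb.
  by rewrite divfK// (phiS _ _ aa).
split; last first.
  move=> a x ca ax; apply: phiE; apply: frac_graphE => //.
  by exists a; split=> //; exact: convergent_expbdd.
split.
- exact: phiE (frac_graphE E1 E1).
- move=> x y; rewrite !inE => /op_QClP[u xu] /op_QClP[v yv].
  by rewrite (phiE _ _ xu) (phiE _ _ yv); apply: phiE; exact: frac_graphB.
- move=> x y; rewrite !inE => /op_QClP[u xu] /op_QClP[v yv].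
  by rewrite (phiE _ _ xu) (phiE _ _ yv); apply: phiE; exact: frac_graphM.
- move=> x y; rewrite !inE => /op_QClP[u xu] /op_QClP[v yv].
  rewrite (phiE _ _ xu) (phiE _ _ yv) => uv.
  by apply/(frac_graph_inj E1 EB EM Einj xu yv).
Qed.

Lemma induced_embedding_ex : exists phi : Q -> laurent R[i], induced_embedding iota phi.
Proof.
exists (fun x => xget 0 [set u | QE x u]); apply/induced_embeddingP => x u xu.
case: xgetP => [v _ /= xv|/(_ u)//].
by apply/(frac_graph_inj series_graph1 series_graphB series_graphM series_graph_inj xv xu).
Qed.

End ConvergentSeries.

Theorem theorem4p3 (R : realType) (Q : fieldType) (iota : ctsfun R -> Q)
    (Qfrac : fraction_field iota) (q : R) (q_gt0 : 0 < q) :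
  let tau := op_tau iota q_gt0 in
  let D := op_D iota in
  [/\ forall alpha : nat -> R[i], convergent_pseries alpha ->
        (exists x, op_lseries iota alpha x) /\
        forall x, op_lseries iota alpha x ->
          op_lseries iota (fun n => alpha n * q%:C ^+ n) (tau x) /\
          op_series iota 1
            (fun n => op_scalar iota (n%:R * alpha n) * op_l iota ^+ n.-1)
            (D x),
      DT_subring D tau (op_Cl iota),
      DT_subfield D tau (op_QCl iota),
      exists phi : Q -> laurent R[i], induced_embedding iota phi &
      forall phi : Q -> laurent R[i], induced_embedding iota phi ->
        [/\ {in op_QCl iota, forall x, phi (D x) = laurent_deriv (phi x)},
            {in op_QCl iota, forall x, phi (tau x) = laurent_dilate q%:C (phi x)} &
            DT_subfield (@laurent_deriv R[i]) (laurent_dilate q%:C)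
              [set phi x | x in op_QCl iota]]].
Proof.
move=> tau D.
have E1 := series_graph1 Qfrac; have EB := series_graphB Qfrac.
have EM := series_graphM Qfrac; have Einj := series_graph_inj Qfrac.
have q0 : q%:C != 0 :> R[i] by rewrite (fmorph_eq0 (real_complex R)) gt_eqF.
have dD : derivation D := op_D_derivation Qfrac.
have tt : transforming_operator tau := op_tau_transforming Qfrac q_gt0.
have dL := @laurent_deriv_derivation R[i]; have tL := laurent_dilate_transforming q0.
have QD := frac_graph_derivation E1 EB EM Einj dD dL (@series_graph_D _ _ _ Qfrac).
have Qtau := frac_graph_transforming E1 EB Einj tt tL (series_graph_tau Qfrac q_gt0).
have QB := frac_graphB E1 EB EM Einj.
have QM := frac_graphM EM; have QV := frac_graphV E1 EB Einj.
split; last 1 first.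
- move=> phi /(induced_embeddingP Qfrac) phiE; split.
  + move=> x; rewrite inE => /op_QClP[u xu].
    by rewrite (phiE _ _ xu); apply: phiE; exact: QD.
  + move=> x; rewrite inE => /op_QClP[u xu].
    by rewrite (phiE _ _ xu); apply: phiE; exact: Qtau.
  (* The image is the projection of the relation to the Laurent side, so its closure properties are
     again those of the relation. *)
  have imP u : [set phi x | x in op_QCl iota] u <->
      exists x, frac_graph (series_graph iota) x u.
    split=> [[x /op_QClP[v xv] <-]|[x xu]]; first by exists x; rewrite (phiE _ _ xv).
    by exists x; [apply/op_QClP; exists u|exact: phiE].
  split=> //.
  + split; first by rewrite inE; apply/imP; exists 1; exact: frac_graphE.
    * move=> u v; rewrite !inE => /imP[x xu] /imP[y yv].
      by apply/imP; exists (x - y); exact: QB.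
    * move=> u v; rewrite !inE => /imP[x xu] /imP[y yv].
      by apply/imP; exists (x / y); apply: QM => //; exact: QV.
  + by move=> u /imP[x xu]; apply/imP; exists (D x); exact: QD.
  + by move=> u /imP[x xu]; apply/imP; exists (tau x); exact: Qtau.
- move=> alpha /convergent_expbdd ba; split.
    by have [x [ax _ _]] := op_lseries_ex Qfrac ba; exists x.
  by move=> x ax; split; [exact: op_lseries_tau|exact: op_series_D].
- split=> //.
  + split; first by rewrite inE; apply/op_ClP; exists 1.
    * move=> x y; rewrite !inE => /op_ClP[u xu] /op_ClP[v yv].
      by apply/op_ClP; exists (u - v); exact: EB.
    * move=> x y; rewrite !inE => /op_ClP[u xu] /op_ClP[v yv].
      by apply/op_ClP; exists (u * v); exact: EM.
  + by move=> x /op_ClP[u xu]; apply/op_ClP; exists (laurent_deriv u); exact: series_graph_D.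
  + by move=> x /op_ClP[u xu]; apply/op_ClP; exists (laurent_dilate q%:C u);
      exact: series_graph_tau.
- split=> //.
  + split; first by rewrite inE; apply/op_QClP; exists 1; exact: frac_graphE.
    * move=> x y; rewrite !inE => /op_QClP[u xu] /op_QClP[v yv].
      by apply/op_QClP; exists (u - v); exact: QB.
    * move=> x y; rewrite !inE => /op_QClP[u xu] /op_QClP[v yv].
      by apply/op_QClP; exists (u / v); apply: QM => //; exact: QV.
  + by move=> x /op_QClP[u xu]; apply/op_QClP; exists (laurent_deriv u); exact: QD.
  + by move=> x /op_QClP[u xu]; apply/op_QClP; exists (laurent_dilate q%:C u); exact: Qtau.
- exact: induced_embedding_ex.
Qed.
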